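(* Let $\mathcal{C}_d$ be the set system on $\{0,1\}^d$ consisting of all subsets of the form $R\cap\{0,1\}^d$ with $R$ an axis-parallel box in $\mathbb{R}^d$ (equivalently, all subcubes of $\{0,1\}^d$). Then, as $d\to\infty$, \[ \operatorname{herdisc}\mathcal{C}_d=2^{c_0d+o(d)},\qquad c_0=\log_2(2/\sqrt3). \] The same holds for the set system $\mathcal{A}_d(\{0,1\}^d)=\{A\cap\{0,1\}^d: A=[0,b_1]\times\cdots\times[0,b_d],\ b_i\ge0\}$ induced by anchored boxes.
   Context: For a set system $\mathcal{F}$ on ground set $V$, $\operatorname{disc}\mathcal{F}=\min_{x\in\{-1,1\}^V}\max_{F\in\mathcal{F}}\bigl|\sum_{v\in F}x_v\bigr|$, and $\operatorname{herdisc}\mathcal{F}=\max_{J\subseteq V}\operatorname{disc}(\mathcal{F}|_J)$, where $\mathcal{F}|_J=\{F\cap J:F\in\mathcal{F}\}$. *)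

(* Defs.v *)
From Stdlib Require Import Reals.
From mathcomp Require Import all_boot all_order all_algebra.
From mathcomp Require Import boolp Rstruct.

Set Implicit Arguments.
Unset Strict Implicit.
Unset Printing Implicit Defensive.

Import Order.TTheory GRing.Theory Num.Theory.

Section Disc.
Variable V : finType.

(* a coloring x in {-1,1}^V is encoded by a boolean function (true = +1) *)
Definition sgn (b : bool) : int := if b then Posz 1 else Negz 0.

Definition disc_col (F : {set {set V}}) (x : {ffun V -> bool}) : nat :=
  \max_(S in F) absz (\sum_(v in S) sgn (x v))%R.

Definition disc (F : {set {set V}}) : nat :=
  disc_col F [arg min_(x < [ffun _ => true] ) disc_col F x].

Definition restrict (F : {set {set V}}) (J : {set V}) : {set {set V}} :=
  [set S :&: J | S in F].

Definition herdisc (F : {set {set V}}) : nat :=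
  \max_(J : {set V}) disc (restrict F J).
End Disc.

Definition cube (d : nat) := {ffun 'I_d -> bool}.

Definition b2R (b : bool) : R := if b then 1%R else 0%R.

Definition box_trace (d : nat) (a b : 'I_d -> R) : {set cube d} :=
  [set x : cube d | [forall i, (a i <= b2R (x i))%R && (b2R (x i) <= b i)%R]].

Definition boxes_sys (d : nat) : {set {set cube d}} :=
  [set S : {set cube d} | `[< exists a b : 'I_d -> R, S = box_trace a b >]].

Definition anchored_sys (d : nat) : {set {set cube d}} :=
  [set S : {set cube d} |
     `[< exists b : 'I_d -> R, (forall i, (0 <= b i)%R) /\
                               S = box_trace (fun _ => 0%R) b >]].

Definition log2 (x : R) : R := Rdiv (ln x) (ln 2).
Definition c0 : R := log2 (Rdiv 2 (sqrt 3)).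

(* Main.v *)
Require Import Defs.
From Stdlib Require Import Reals.
From mathcomp Require Import all_boot all_order all_algebra.
From mathcomp Require Import boolp Rstruct.
From mathcomp Require Import ring lra zify.

(** Write [rho = 2 / sqrt 3]. Both bounds hold up to a factor polynomial in [d].

    Lower bound (anchored boxes). Weight the incidence matrix of the system by
    the square roots of tensor-power probability measures on its rows and
    columns. Its singular values are then products of the two one-dimensional
    ones, [(sqrt 3 + 1) / 3] and [(sqrt 3 - 1) / 3], whose sum is [rho]; hence
    some singular value [s] of multiplicity [k] has [k s >= rho^d / (d + 1)].
    Greedily choose about [k / 2] columns whose Gram-Schmidt lengths are at
    least [g = s sqrt (k / 2)]. Every subset of these columns is the support of
    a colouring with small image. Decoding the colourings along the triangular
    Gram-Schmidt system shows that [2^(k/2)] of them cannot all have fewer than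
    a constant proportion of coordinates of size [g / 2], so the hereditary
    discrepancy is at least of order [g sqrt k], that is [k s].

    Upper bound (all boxes). The incidence vectors of subcubes factor as
    [<b_S, c_v>] with [|c_v| = 1] and [|b_S| = rho^d]. On any [n] points,
    project away a maximal orthonormal family on which the matrix of the [c_v]
    has square norm at least of order [d]; it has [O(n / d)] members, and the
    projected sets have norm [O(sqrt d) rho^d]. Hoeffding's inequality and the
    pigeonhole principle produce two colourings that nearly agree on the family,
    are good for all the sets, and differ in at least [n / (4 (d + 1))] points;
    half their difference is a partial colouring. Iterating [O(d^2)] times
    colours everything. *)

Set Implicit Arguments.
Unset Strict Implicit.
Unset Printing Implicit Defensive.

Import Order.TTheory GRing.Theory Num.Theory.
Local Open Scope ring_scope.
(* [R] is bound to [R_scope] by the standard library; without this, arguments of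
   type [R] would be parsed with the operations of [R_scope]. *)
Bind Scope ring_scope with R.

(** * Orthonormal families *)

Definition dot (I : finType) (u v : I -> R) : R := \sum_i u i * v i.

Definition orthonormal_upto (I : finType) (r : nat) (e : nat -> I -> R) :=
  forall a b, (a < r)%N -> (b < r)%N -> dot (e a) (e b) = (a == b)%:R.

Definition residual (I : finType) (r : nat) (e : nat -> I -> R) (u : I -> R) :
    I -> R :=
  fun i => u i - \sum_(a < r) dot (e a) u * e a i.

Definition extend (I : finType) (r : nat) (e : nat -> I -> R) (u : I -> R) :
    nat -> I -> R :=
  fun n => if n == r then u else e n.

Lemma dotC (I : finType) (u v : I -> R) : dot u v = dot v u.
Proof. by apply: eq_bigr => i _; rewrite mulrC. Qed.

Lemma dot_ge0 (I : finType) (u : I -> R) : 0 <= dot u u.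
Proof. by apply: sumr_ge0 => i _; rewrite -expr2 sqr_ge0. Qed.

Lemma dotZr (I : finType) (c : R) (u v : I -> R) :
  dot u (fun i => c * v i) = c * dot u v.
Proof. by rewrite /dot mulr_sumr; apply: eq_bigr => i _; rewrite mulrCA. Qed.

Lemma dotBr (I : finType) (u v w : I -> R) :
  dot u (fun i => v i - w i) = dot u v - dot u w.
Proof. by rewrite /dot -sumrB; apply: eq_bigr => i _; rewrite mulrBr. Qed.

Lemma dot_sumr (I J : finType) (u : I -> R) (F : J -> I -> R) :
  dot u (fun i => \sum_j F j i) = \sum_j dot u (F j).
Proof.
by rewrite /dot exchange_big; apply: eq_bigr => i _; rewrite mulr_sumr.
Qed.

Lemma dot_norm_le (I : finType) (u v : I -> R) :
  (forall i, `|u i| <= 1) -> (forall i, `|v i| <= 1) -> `|dot u v| <= #|I|%:R.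
Proof.
move=> u1 v1; apply: le_trans (ler_norm_sum _ _ _) _.
rewrite -sum1_card natr_sum; apply: ler_sum => i _.
by rewrite normrM; apply: mulr_ile1.
Qed.

Lemma entry_le1 (I : finType) (u : I -> R) (i : I) :
  dot u u = 1 -> `|u i| <= 1.
Proof.
move=> u1; rewrite -(@expr_le1 _ 2) // real_normK ?num_real // -u1 /dot.
rewrite (bigD1 i) //= -expr2 lerDl.
by apply: sumr_ge0 => j _; rewrite -expr2 sqr_ge0.
Qed.

Lemma dot_residual_l (I : finType) r (e : nat -> I -> R) (u : I -> R) a :
  orthonormal_upto r e -> (a < r)%N -> dot (e a) (residual r e u) = 0.
Proof.
move=> on ar; rewrite /residual dotBr dot_sumr (bigD1 (Ordinal ar)) //=.
rewrite dotZr on // eqxx mulr1 big1 ?addr0 ?subrr // => b ba.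
rewrite dotZr on //; case: eqP => [ab|]; last by rewrite mulr0.
by case/eqP: ba; apply: val_inj.
Qed.

Lemma dot_residual_r (I : finType) r (e : nat -> I -> R) (u v : I -> R) :
  orthonormal_upto r e ->
  dot (residual r e u) v = dot (residual r e u) (residual r e v).
Proof.
move=> on; rewrite {3}/residual dotBr dot_sumr big1 ?subr0 // => a _.
by rewrite dotZr (dotC (residual _ _ _)) dot_residual_l // mulr0.
Qed.

Lemma residual_sqnorm (I : finType) r (e : nat -> I -> R) (u : I -> R) :
  orthonormal_upto r e ->
  dot (residual r e u) (residual r e u) =
  dot u u - \sum_(a < r) dot (e a) u ^+ 2.
Proof.
move=> on; rewrite -dot_residual_r // dotC /residual dotBr dot_sumr.
congr (_ - _); apply: eq_bigr => a _.
by rewrite dotZr (dotC u) expr2.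
Qed.

Lemma bessel (I : finType) r (e : nat -> I -> R) (u : I -> R) :
  orthonormal_upto r e -> \sum_(a < r) dot (e a) u ^+ 2 <= dot u u.
Proof.
by move=> on; rewrite -subr_ge0 -residual_sqnorm // dot_ge0.
Qed.

Lemma bessel_fin (I A : finType) (P : pred A) (w : A -> I -> R) (u : I -> R) :
  (forall a b, dot (w a) (w b) = (a == b)%:R) ->
  \sum_(a | P a) dot (w a) u ^+ 2 <= dot u u.
Proof.
move=> on; apply: (@le_trans _ _ (\sum_a dot (w a) u ^+ 2)).
  rewrite [leRHS](bigID P) /= lerDl; apply: sumr_ge0 => a _; exact: sqr_ge0.
pose e n i := if insub n is Some o then w (@enum_val A predT o) i else 0.
have eE (o : 'I_#|A|) : e o = w (enum_val o).
  by apply: funext => i; rewrite /e valK.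
have oe : orthonormal_upto #|A| e.
  move=> a b al bl; rewrite -[a]/(val (Ordinal al)) -[b]/(val (Ordinal bl)).
  by rewrite !eE on (inj_eq enum_val_inj).
apply: le_trans (bessel u oe); rewrite (reindex (@enum_val A predT)) /=; last first.
  exact/onW_bij/enum_val_bij.
by apply: ler_sum => o _; rewrite eE.
Qed.

Lemma dot_cauchy (I : finType) (u v : I -> R) :
  dot u v ^+ 2 <= dot u u * dot v v.
Proof.
have [u0|u0] := eqVneq (dot u u) 0.
  have uz i : u i = 0.
    apply/eqP; rewrite -sqrf_eq0; move/eqP: u0; rewrite psumr_eq0 => [|j _].
      by move/allP/(_ i); rewrite mem_index_enum expr2 => /(_ isT).
    by rewrite -expr2 sqr_ge0.
  rewrite u0 mul0r /dot big1 ?expr0n // => i _; by rewrite uz mul0r.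
have up : 0 < dot u u by rewrite lt_def u0 dot_ge0.
pose s := Num.sqrt (dot u u).
have s2 : s ^+ 2 = dot u u by rewrite sqr_sqrtr ?ltW.
have on : orthonormal_upto 1 (fun _ i => s^-1 * u i).
  move=> [|//] [|//] _ _; by rewrite dotZr dotC dotZr mulrA -expr2 exprVn s2 mulVf.
have := bessel v on; rewrite big_ord1 (dotC _ v) dotZr (dotC v) exprMn exprVn s2.
by rewrite mulrC ler_pdivrMr // mulrC.
Qed.

Lemma extend_orthonormal (I : finType) r (e : nat -> I -> R) (u : I -> R) :
  orthonormal_upto r e -> (forall a, (a < r)%N -> dot (e a) u = 0) ->
  dot u u = 1 -> orthonormal_upto r.+1 (extend r e u).
Proof.
move=> on o1 n1 a b; rewrite !ltnS /extend => al bl.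
have [ea|ar] := eqVneq a r; have [eb|br] := eqVneq b r.
- by rewrite ea eb eqxx.
- have br' : (b < r)%N by rewrite ltn_neqAle br.
  by rewrite dotC o1 // ea eq_sym (negPf br).
- have ar' : (a < r)%N by rewrite ltn_neqAle ar.
  by rewrite o1 // eb (negPf ar).
by rewrite on // ltn_neqAle ?ar ?br.
Qed.

Definition unit_residual (I : finType) r (e : nat -> I -> R) (u : I -> R) :
    I -> R :=
  fun i => (Num.sqrt (dot (residual r e u) (residual r e u)))^-1
           * residual r e u i.

Lemma extend_unit_residual (I : finType) r (e : nat -> I -> R) (u : I -> R) :
  orthonormal_upto r e -> 0 < dot (residual r e u) (residual r e u) ->
  orthonormal_upto r.+1 (extend r e (unit_residual r e u)).
Proof.
move=> on p; apply: extend_orthonormal => // [a ar|].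
  by rewrite dotZr dot_residual_l // mulr0.
rewrite dotZr dotC dotZr mulrA -expr2 exprVn sqr_sqrtr ?ltW // mulVf //.
by rewrite gt_eqF.
Qed.

Lemma dot_unit_residual (I : finType) r (e : nat -> I -> R) (u : I -> R) :
  orthonormal_upto r e -> 0 < dot (residual r e u) (residual r e u) ->
  dot (unit_residual r e u) u = Num.sqrt (dot (residual r e u) (residual r e u)).
Proof.
move=> on p; rewrite dotC dotZr (dotC u) (dot_residual_r u u on).
rewrite -[in X in _ * X](sqr_sqrtr (ltW p)) expr2 mulrA mulVf ?mul1r //.
by rewrite sqrtr_eq0 -ltNge.
Qed.

(** * Triangular systems and greedy column selection *)

Lemma residual_extend (I : finType) r (e : nat -> I -> R) (u x : I -> R) :
  orthonormal_upto r e -> orthonormal_upto r.+1 (extend r e u) ->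
  dot (residual r.+1 (extend r e u) x) (residual r.+1 (extend r e u) x) =
  dot (residual r e x) (residual r e x) - dot u x ^+ 2.
Proof.
move=> on on'; rewrite !residual_sqnorm // big_ord_recr /= {2}/extend eqxx.
rewrite opprD addrA; congr (_ - _ - _); apply: eq_bigr => a _.
by rewrite /extend ltn_eqF.
Qed.

(** Gram-Schmidt in which each new column is picked for its long residual; the normalised residual
    becomes the next member of [e]. *)
Lemma greedy_columns (I V : finType) (v0 : V) (X : V -> I -> R) (g : R) k :
  0 < g ->
  (forall r e, (r < k)%N -> orthonormal_upto r e ->
     exists v, g ^+ 2 <= dot (residual r e (X v)) (residual r e (X v))) ->
  exists (j : nat -> V) (e : nat -> I -> R),
    [/\ orthonormal_upto k e,
        forall a, (a < k)%N -> g <= dot (e a) (X (j a)) &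
        forall a b, (a < b)%N -> (b < k)%N -> dot (e b) (X (j a)) = 0].
Proof.
move=> g0 H.
(* The extra invariant, zero residual for the chosen columns, places them in the span of [e]; by
   Cauchy-Schwarz the next unit vector is then orthogonal to them. *)
suff [j [e [h1 h2 h3 _]]] : exists (j : nat -> V) (e : nat -> I -> R),
    [/\ orthonormal_upto k e,
        forall a, (a < k)%N -> g <= dot (e a) (X (j a)),
        forall a b, (a < b)%N -> (b < k)%N -> dot (e b) (X (j a)) = 0 &
        forall a, (a < k)%N ->
          dot (residual k e (X (j a))) (residual k e (X (j a))) = 0].
  by exists j, e.
elim: k H => [|k IH] H.
  by exists (fun _ => v0), (fun _ _ => 0).
have [|j [e [on pos tri res0]]] := IH; first by move=> r e rk; apply: H; lia.
have [v vg] := H k e (ltnSn k) on.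
set N := dot _ _ in vg.
have N0 : 0 < N by apply: lt_le_trans vg; rewrite exprn_gt0.
have on' := extend_unit_residual on N0.
set u := unit_residual k e (X v) in on'.
have uX : dot u (X v) = Num.sqrt N by apply: dot_unit_residual.
have ujE a : (a < k)%N -> dot u (X (j a)) = 0.
  move=> ak; rewrite /u dotC dotZr (dotC (X _)) (dot_residual_r _ (X (j a)) on).
  have := dot_cauchy (residual k e (X v)) (residual k e (X (j a))).
  rewrite res0 // mulr0 => h.
  have /eqP -> : dot (residual k e (X v)) (residual k e (X (j a))) == 0.
    by rewrite -sqrf_eq0 eq_le h sqr_ge0.
  by rewrite mulr0.
exists (fun n => if n == k then v else j n), (extend k e u); split => //.
- move=> a; rewrite ltnS /extend leq_eqVlt => /predU1P[->|ak].
    rewrite eqxx uX -(@ler_pXn2r _ 2) ?nnegrE ?sqrtr_ge0 ?(ltW g0) //.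
    by rewrite sqr_sqrtr // ltW.
  by rewrite ltn_eqF // pos.
- move=> a b ab; rewrite ltnS /extend leq_eqVlt => /predU1P[bk|bk].
    by rewrite bk eqxx ltn_eqF -?bk // ujE // -bk.
  by rewrite !ltn_eqF ?tri // (ltn_trans ab).
- move=> a; rewrite ltnS leq_eqVlt residual_extend // => /predU1P[->|ak].
    by rewrite eqxx -/N uX sqr_sqrtr ?subrr // ltW.
  by rewrite ltn_eqF // res0 // ujE // expr0n subr0.
Qed.

(** Partial colours: [None] stands for an uncoloured point. *)
Definition sval3 (o : option bool) : R :=
  if o is Some b then (sgn b)%:~R else 0.

Lemma sval3_gap (o o' : option bool) : o != o' -> 1 <= `|sval3 o - sval3 o'|.
Proof.
have s1 : sval3 (Some true) = 1 by [].
have s2 : sval3 (Some false) = -1 by [].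
have s3 : sval3 None = 0 by [].
case: o o' => [[]|] [[]|] // _; rewrite ?s1 ?s2 ?s3 ler_normr;
  by apply/orP; solve [left; lra | right; lra].
Qed.

(* Coordinates are decoded from the last to the first: as [t] is triangular, a
   coordinate whose image is smaller than [g / 2] is determined by the later
   ones, so only the large coordinates have to be recorded. *)
Lemma large_coordinates_inj k (t : 'I_k -> 'I_k -> R) (g : R)
    (z z' : 'I_k -> option bool) (large : ('I_k -> option bool) -> pred 'I_k) :
  0 < g -> (forall b, g <= t b b) ->
  (forall a b : 'I_k, (a < b)%N -> t b a = 0) ->
  (forall z b, large z b = (g / 2 <= `|\sum_a sval3 (z a) * t b a|)) ->
  (forall b, (if large z b then Some (z b) else None) =
             (if large z' b then Some (z' b) else None)) ->
  forall b, z b = z' b.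
Proof.
move=> g0 diag tri lE H.
suff dec m (b : 'I_k) : (k - b <= m)%N -> z b = z' b by move=> b; apply: (dec k); lia.
elim: m b => [|m IH] b bm; first by have := ltn_ord b; lia.
have := H b; case: ifP => lz; case: ifP => // lz'; first by case.
move=> _; apply/eqP/negP => /negP ne.
have : `|\sum_a sval3 (z a) * t b a - \sum_a sval3 (z' a) * t b a| < g.
  move/negbT: lz; move/negbT: lz'; rewrite !lE -!ltNge => h1 h2.
  by apply: le_lt_trans (ler_normB _ _) _; lra.
apply/negP; rewrite -leNgt -sumrB (bigD1 b) //= big1 ?addr0.
  rewrite -mulrBl normrM; have := sval3_gap ne; have := diag b.
  by move=> h1 h2; rewrite [X in _ * X]ger0_norm; nra.
move=> a ab; have [lt|] := ltnP a b; first by rewrite tri // !mulr0 subrr.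
rewrite leq_eqVlt eq_sym => /predU1P[/val_inj|] ba; first by rewrite ba eqxx in ab.
by rewrite IH ?subrr //; have := ltn_ord a; lia.
Qed.

(** A weighted count. Distinct sets have distinct codes. A recorded coordinate weighs 1/4 whichever
    of its three values it takes, an unrecorded one weighs 1, so all words together weigh [(7/4)^k].
    If every code recorded fewer than [k / 11] coordinates, each would weigh more than [(7/8)^k],
    and the [2^k] codes would exceed the total. *)
Lemma triangular_many_large k (t : 'I_k -> 'I_k -> R) (g : R)
    (z : {set 'I_k} -> 'I_k -> option bool) :
  0 < g -> (forall b, g <= t b b) ->
  (forall a b : 'I_k, (a < b)%N -> t b a = 0) ->
  (forall A a, (z A a != None) = (a \in A)) ->
  exists A,
    (k <= 11 * #|[set b | (g / 2 <= `|\sum_a sval3 (z A a) * t b a|)%R]|)%N.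
Proof.
move=> g0 diag tri supp.
pose large z b := g / 2 <= `|\sum_a sval3 (z a) * t b a|.
apply: contrapT => /forallNP H.
pose code A := [ffun b => if large (z A) b then Some (z A b) else None].
have code_inj : injective code.
  move=> A B AB.
  have E : forall b, z A b = z B b.
    apply: (large_coordinates_inj g0 diag tri (large := large)) => // b.
    by move/ffunP: AB => /(_ b); rewrite !ffunE.
  by apply/setP => a; rewrite -!supp E.
pose w (o : option (option bool)) : R := if o is Some _ then 1 / 4 else 1.
have w0 o : 0 <= w o by case: o => [o|] /=; lra.
have sumw : \sum_(c : {ffun 'I_k -> option (option bool)}) \prod_b w (c b)
    = (7 / 4) ^+ k.
  rewrite -(bigA_distr_bigA (fun _ => w)) prodr_const card_ord; congr (_ ^+ _).
  rewrite -big_enum /= !enumT !unlock /= unlock /=.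
  by rewrite /option_enum ?unlock /= ?unlock /=; lra.
have : \sum_(A : {set 'I_k}) \prod_b w (code A b) <= (7 / 4) ^+ k.
  rewrite -sumw [leRHS](bigID (mem (code @: setT))) /= big_imset /=; last first.
    by move=> A B _ _; apply: code_inj.
  under [X in _ <= X + _]eq_bigl do rewrite inE.
  rewrite lerDl; apply: sumr_ge0 => c _; exact: prodr_ge0.
apply/negP; rewrite -ltNge.
have -> : (7 / 4) ^+ k = \sum_(A : {set 'I_k}) (7 / 8) ^+ k :> R.
  rewrite sumr_const -cardsT -powersetT card_powerset cardsT card_ord.
  by rewrite -[RHS]mulr_natl natrX -exprMn; congr (_ ^+ _); lra.
have lt A : (7 / 8) ^+ k < \prod_b w (code A b).
  have -> : \prod_b w (code A b) = (1 / 4) ^+ #|[set b | large (z A) b]|.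
    rewrite (bigID (large (z A))) /= [X in _ * X]big1 ?mulr1; last first.
      by move=> b nb; rewrite ffunE (negPf nb).
    rewrite (eq_bigr (fun=> 1 / 4)); last by move=> b lb; rewrite ffunE lb.
    by rewrite prodr_const; congr (_ ^+ _); apply: eq_card => b; rewrite inE.
  have /negP := H A; rewrite -ltnNge -/large; set n := #|_| => nk.
  (* The constant 11 comes from [(7/8)^11 <= 1/4]; the leftover exponent is positive, which makes
     the bound strict. *)
  have -> : (k = 11 * n + (k - 11 * n).-1.+1)%N by lia.
  rewrite exprD exprM.
  have h1 : (7 / 8) ^+ 11 ^+ n <= (1 / 4) ^+ n :> R.
    by rewrite lerXn2r ?nnegrE ?exprn_ge0 //; lra.
  have h2 : 0 < (7 / 8) ^+ 11 ^+ n :> R by rewrite !exprn_gt0 //; lra.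
  apply: lt_le_trans h1; rewrite -[ltRHS]mulr1 ltr_pM2l //.
  by rewrite exprn_ilt1 //; lra.
apply: ltr_sum; first by apply/hasP; exists set0; rewrite ?mem_index_enum.
by move=> A _; apply: lt.
Qed.

(** * Hereditary discrepancy *)

Lemma discP (V : finType) (F : {set {set V}}) :
  exists x : {ffun V -> bool}, forall S, S \in F ->
    (absz (\sum_(v in S) sgn (x v))%R <= Defs.disc F)%N.
Proof.
rewrite /Defs.disc; case: arg_minnP => // x _ _; exists x => S SF.
exact: (@leq_bigmax_cond _ (mem F) (fun S => absz (\sum_(v in S) sgn (x v))%R)).
Qed.

Lemma disc_le (V : finType) (F : {set {set V}}) (x : {ffun V -> bool}) D :
  (forall S, S \in F -> (absz (\sum_(v in S) sgn (x v))%R <= D)%N) ->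
  (Defs.disc F <= D)%N.
Proof.
move=> H; rewrite /Defs.disc; case: arg_minnP => // y _ /(_ x isT) le.
by apply: leq_trans le _; apply/bigmax_leqP.
Qed.

Lemma herdiscP (V : finType) (F : {set {set V}}) (J : {set V}) :
  exists x : {ffun V -> bool}, forall S, S \in F ->
    (absz (\sum_(v in S :&: J) sgn (x v))%R <= herdisc F)%N.
Proof.
have [x H] := discP (restrict F J); exists x => S SF.
apply: leq_trans (H (S :&: J) _) _; first exact: imset_f.
exact: (@leq_bigmax _ (fun J => Defs.disc (restrict F J))).
Qed.

Lemma herdisc_le (V : finType) (F : {set {set V}}) D :
  (forall J : {set V}, exists x : {ffun V -> bool}, forall S, S \in F ->
    (absz (\sum_(v in S :&: J) sgn (x v))%R <= D)%N) ->
  (herdisc F <= D)%N.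
Proof.
move=> H; apply/bigmax_leqP => J _; have [x Hx] := H J.
by apply: (@disc_le _ _ x) => _ /imsetP[S SF ->]; apply: Hx.
Qed.

Lemma herdisc_subset (V : finType) (F G : {set {set V}}) :
  F \subset G -> (herdisc F <= herdisc G)%N.
Proof.
move/subsetP => FG; apply: herdisc_le => J; have [x H] := herdiscP G J.
by exists x => S /FG; apply: H.
Qed.

Lemma absz_sum_sgn (V : finType) (A : {set V}) (x : V -> bool) :
  (absz (\sum_(v in A) sgn (x v))%R)%:R = `|\sum_(v in A) (sgn (x v))%:~R| :> R.
Proof.
by rewrite natr_absz intr_norm raddf_sum.
Qed.

(** Colouring any subset of the selected columns with discrepancy [D] gives an image of norm at most
    [D], because the weights [h] have norm at most 1. For some subset, at least [k / 11] coordinates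
    of the image along [e] reach [g / 2], so Bessel gives [(k / 11) (g^2 / 4) <= D^2]; hence 44. *)
Lemma herdisc_lower (V I : finType) (F : {set {set V}}) (S : I -> {set V})
    (h : I -> R) (g : R) k :
  (forall i, S i \in F) -> dot h h <= 1 -> 0 < g ->
  let X v i : R := h i * (v \in S i)%:R in
  (forall r e, (r < k)%N -> orthonormal_upto r e ->
     exists v, g ^+ 2 <= dot (residual r e (X v)) (residual r e (X v))) ->
  k%:R * g ^+ 2 <= 44 * (herdisc F)%:R ^+ 2 :> R.
Proof.
move=> SF h1 g0 X H.
have [->|k0] := posnP k; first by rewrite mul0r mulr_ge0 ?sqr_ge0.
have [|v0 _] := H 0%N (fun _ _ => 0) k0; first by [].
have [j [e [on diag tri]]] := greedy_columns v0 g0 H.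
(* If a column were chosen twice, a diagonal entry would equal an entry that triangularity makes
   zero. *)
have jinj a b : (a < k)%N -> (b < k)%N -> j a = j b -> a = b.
  wlog ab : a b / (a < b)%N => [W|] ak bk ejab.
    by case: (ltngtP a b) => // lt; [|apply/esym]; apply: W.
  by exfalso; have := diag b bk; rewrite -ejab (tri a b ab bk); lra.
pose t (b a : 'I_k) := dot (e b) (X (j a)).
pose D := (herdisc F)%:R : R.
have colA (A : {set 'I_k}) : {z : 'I_k -> option bool |
    (forall a, (z a != None) = (a \in A)) /\
    dot (fun i => \sum_a sval3 (z a) * X (j a) i)
        (fun i => \sum_a sval3 (z a) * X (j a) i) <= D ^+ 2}.
  apply: cid; have [x Hx] := herdiscP F [set j (val a) | a in A].
  exists (fun a => if a \in A then Some (x (j a)) else None).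
  split=> [a|]; first by case: ifP.
  apply: (@le_trans _ _ (\sum_i h i * h i * D ^+ 2)); last first.
    by rewrite -mulr_suml ler_piMl ?sqr_ge0.
  apply: ler_sum => i _.
  have -> : \sum_a sval3 (if a \in A then Some (x (j a)) else None) * X (j a) i
      = h i * \sum_(v in S i :&: [set j (val a) | a in A]) (sgn (x v))%:~R.
    rewrite (eq_bigl (fun v => (v \in [set j (val a) | a in A]) && (v \in S i))).
      rewrite big_imset_cond /=; last first.
        by move=> a b _ _ /jinj; move/(_ (ltn_ord a) (ltn_ord b))/val_inj.
      rewrite mulr_sumr [RHS]big_mkcond; apply: eq_bigr => a _.
      case: (a \in A) => /=; last by rewrite mul0r.
      by rewrite /X; case: (j a \in S i); rewrite ?mulr1 ?mulr0 // mulrC.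
    by move=> v; rewrite inE andbC.
  rewrite mulrACA -!expr2 ler_wpM2l ?sqr_ge0 //.
  rewrite -[leLHS]real_normK ?num_real // lerXn2r ?nnegrE ?ler0n //.
  by rewrite -absz_sum_sgn ler_nat Hx.
pose z A := sval (colA A).
have [A] : exists A,
    (k <= 11 * #|[set b | (g / 2 <= `|\sum_a sval3 (z A a) * t b a|)%R]|)%N.
  apply: triangular_many_large => //.
  - by move=> b; apply: diag.
  - by move=> a b ab; apply: tri.
  - by move=> A a; rewrite /z; case: (colA A) => z0 [] /=.
set B := [set b | _] => kB.
have [_ zD] := svalP (colA A); rewrite -/(z A) in zD.
have dE b : dot (e b) (fun i => \sum_a sval3 (z A a) * X (j a) i)
    = \sum_a sval3 (z A a) * dot (e b) (X (j a)).
  by rewrite (dot_sumr (e b) (fun (a : 'I_k) i => _)); apply: eq_bigr => a _; rewrite dotZr.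
have := le_trans (bessel _ on) zD.
have : #|B|%:R * (g ^+ 2 / 4) <=
    \sum_(b < k) dot (e b) (fun i => \sum_a sval3 (z A a) * X (j a) i) ^+ 2.
  rewrite mulr_natl -sumr_const [leRHS](bigID (mem B)) /= -[leLHS]addr0.
  apply: lerD; last by apply: sumr_ge0 => b _; apply: sqr_ge0.
  apply: ler_sum => b; rewrite inE -dE => lb.
  rewrite -[leRHS]real_normK ?num_real //; nra.
have : k%:R <= 11 * #|B|%:R :> R by rewrite -natrM ler_nat.
rewrite -/D; set s := \sum_(_ < _) _; move: (g ^+ 2) (exprn_gt0 2 g0) => G G0.
move: (k%:R) (#|B|%:R) (D ^+ 2) => kk bb DD *; nra.
Qed.

(** * Lower bound for anchored boxes *)

(** The hypothesis equates two expressions of one symmetric matrix, and each side is its quadratic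
    form at [u]. *)
Lemma spectral_quadratic (I V A : finType) (q : V -> R) (X : V -> I -> R)
    (s2 : A -> R) (w : A -> I -> R) (u : I -> R) :
  (forall y y', \sum_x q x * (X x y * X x y') = \sum_a s2 a * (w a y * w a y')) ->
  \sum_x q x * dot u (X x) ^+ 2 = \sum_a s2 a * dot (w a) u ^+ 2.
Proof.
move=> H.
have expand (B : finType) (c : B -> R) (Z : B -> I -> R) :
    \sum_b c b * dot u (Z b) ^+ 2 =
    \sum_y \sum_y' u y * u y' * \sum_b c b * (Z b y * Z b y').
  under eq_bigr => b _.
    rewrite expr2 /dot mulr_suml mulr_sumr.
    under eq_bigr => y _ do rewrite !mulr_sumr.
    over.
  rewrite exchange_big; apply: eq_bigr => y _ /=.
  rewrite exchange_big; apply: eq_bigr => y' _ /=.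
  by rewrite mulr_sumr; apply: eq_bigr => b _; ring.
under [RHS]eq_bigr => a _ do rewrite dotC.
rewrite !expand; apply: eq_bigr => y _; apply: eq_bigr => y' _.
by rewrite H.
Qed.

Lemma exists_ge_average (V : finType) (q F : V -> R) :
  (forall x, 0 <= q x) -> \sum_x q x = 1 -> exists x, \sum_x q x * F x <= F x.
Proof.
move=> q0 q1; apply: contrapT => /forallNP H.
have {}H x : F x < \sum_x q x * F x by have /negP := H x; rewrite -ltNge.
set m := \sum_x _ in H.
have : \sum_x q x * (m - F x) = 0.
  under eq_bigr do rewrite mulrBr.
  by rewrite sumrB -mulr_suml q1 mul1r subrr.
move/eqP; rewrite psumr_eq0 => [/allP Z|x _]; last first.
  by rewrite mulr_ge0 // subr_ge0 ltW.
move: q1; rewrite big1 ?(rwP eqP) 1?eq_sym ?oner_eq0 // => x _.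
have := Z x (mem_index_enum x).
by rewrite mulf_eq0 [m - _ == 0]gt_eqF ?orbF ?subr_gt0 // => /eqP.
Qed.

(* The [k] eigenvectors in [P] keep at least [k - r] of their total mass after
   projecting away [r] directions. *)
Lemma spectral_residual (I V A : finType) (q : V -> R) (X : V -> I -> R)
    (sg : A -> R) (w : A -> I -> R) (P : pred A) (s : R) r (e : nat -> I -> R) :
  (forall y y', \sum_x q x * (X x y * X x y') =
                \sum_a sg a ^+ 2 * (w a y * w a y')) ->
  (forall a b, dot (w a) (w b) = (a == b)%:R) ->
  (forall x, 0 <= q x) -> \sum_x q x = 1 ->
  (forall a, P a -> sg a = s) -> (2 * r <= #|P|)%N -> orthonormal_upto r e ->
  exists v, s ^+ 2 * #|P|%:R / 2 <= dot (residual r e (X v)) (residual r e (X v)).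
Proof.
move=> spec wo q0 q1 sP rk on.
have [v Hv] := exists_ge_average (fun x =>
  dot (residual r e (X x)) (residual r e (X x))) q0 q1.
exists v; apply: le_trans Hv.
(* The trace of the same matrix, read off from both expressions. *)
have trE : \sum_x q x * dot (X x) (X x) = \sum_a sg a ^+ 2.
  under eq_bigr do rewrite /dot mulr_sumr.
  rewrite exchange_big /=; under eq_bigr do rewrite spec.
  rewrite exchange_big /=; apply: eq_bigr => a _.
  by rewrite -mulr_sumr -[X in _ * X]/(dot (w a) (w a)) wo eqxx mulr1.
have -> : \sum_x q x * dot (residual r e (X x)) (residual r e (X x)) =
    \sum_a sg a ^+ 2 * (1 - \sum_(b < r) dot (e b) (w a) ^+ 2).
  under eq_bigr do rewrite residual_sqnorm // mulrBr.
  rewrite sumrB trE; under [X in _ - X]eq_bigr do rewrite mulr_sumr.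
  rewrite exchange_big /=.
  under [X in _ - X]eq_bigr => b _ do rewrite (spectral_quadratic _ spec).
  rewrite exchange_big /= -sumrB; apply: eq_bigr => a _.
  rewrite mulrBr mulr1 mulr_sumr; congr (_ - _); apply: eq_bigr => b _.
  by rewrite dotC.
rewrite [leRHS](bigID P) /= -[leLHS]addr0; apply: lerD; last first.
  apply: sumr_ge0 => a _; rewrite mulr_ge0 ?sqr_ge0 // subr_ge0.
  by apply: le_trans (bessel _ on) _; rewrite wo eqxx.
rewrite (eq_bigr (fun a => s ^+ 2 * (1 - \sum_(b < r) dot (e b) (w a) ^+ 2)));
  last by move=> a Pa; rewrite sP.
rewrite -mulr_sumr -mulrA ler_wpM2l ?sqr_ge0 // sumrB sumr_const exchange_big /=.
(* Bessel with the roles exchanged: each unit vector [e b] is expanded along the orthonormal family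
   [w]. *)
have : \sum_(b < r) \sum_(a | P a) dot (e b) (w a) ^+ 2 <= r%:R.
  have -> : r%:R = \sum_(b < r) 1 :> R by rewrite sumr_const card_ord.
  apply: ler_sum => b _; under eq_bigr do rewrite dotC.
  by apply: le_trans (bessel_fin _ _ wo) _; rewrite on // eqxx.
have : 2 * r%:R <= #|P|%:R :> R by rewrite -natrM ler_nat.
by lra.
Qed.

Lemma sum_cube_prod d (F : 'I_d -> bool -> R) :
  \sum_(x : cube d) \prod_i F i (x i) = \prod_i (F i true + F i false).
Proof.
rewrite -bigA_distr_bigA; apply: eq_bigr => i _.
by rewrite big_bool.
Qed.

(* One coordinate of the optimal dual solution: [lb_h] holds the square roots of
   the row weights (2/3, 1/3), [lb_q] the column weights, [lb_sg] the singular
   values of the weighted matrix and [lb_w] its left singular vectors. *)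
Definition lb_h (y : bool) : R :=
  if y then Num.sqrt 2 * Num.sqrt 3 / 3 else Num.sqrt 3 / 3.
Definition lb_q (x : bool) : R := if x then 1 / 3 else 2 / 3.
Definition lb_sg (a : bool) : R :=
  if a then (Num.sqrt 3 - 1) / 3 else (Num.sqrt 3 + 1) / 3.
Definition lb_cos : R := Num.sqrt ((3 - Num.sqrt 3) / 6).
Definition lb_sin : R := Num.sqrt ((3 + Num.sqrt 3) / 6).
Definition lb_w (a y : bool) : R :=
  if a then (if y then - lb_cos else lb_sin) else
  (if y then lb_sin else lb_cos).

Lemma sqrt2_sq : Num.sqrt 2 ^+ 2 = 2 :> R.
Proof. by rewrite sqr_sqrtr. Qed.

Lemma sqrt3_sq : Num.sqrt 3 ^+ 2 = 3 :> R.
Proof. by rewrite sqr_sqrtr. Qed.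

Lemma sqrt3_gt1 : 1 < Num.sqrt 3 :> R.
Proof. by have := sqrt3_sq; have : 0 <= Num.sqrt 3 :> R := sqrtr_ge0 _; nra. Qed.

Lemma sqrt3_lt3 : Num.sqrt 3 < 3 :> R.
Proof. by have := sqrt3_sq; have : 0 <= Num.sqrt 3 :> R := sqrtr_ge0 _; nra. Qed.

Lemma lb_cos_sq : lb_cos ^+ 2 = (3 - Num.sqrt 3) / 6.
Proof. by rewrite sqr_sqrtr //; have := sqrt3_lt3; lra. Qed.

Lemma lb_sin_sq : lb_sin ^+ 2 = (3 + Num.sqrt 3) / 6.
Proof. by rewrite sqr_sqrtr //; have := sqrt3_gt1; lra. Qed.

Lemma lb_cos_sin : lb_cos * lb_sin = Num.sqrt 2 * Num.sqrt 3 / 6.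
Proof.
apply/eqP; rewrite -(@eqrXn2 _ 2) //; last 2 first.
- by rewrite mulr_ge0 ?sqrtr_ge0.
- by rewrite divr_ge0 ?mulr_ge0 ?sqrtr_ge0.
rewrite !exprMn lb_cos_sq lb_sin_sq sqrt2_sq sqrt3_sq.
by apply/eqP; have := sqrt3_sq; rewrite !expr2 => h; nra.
Qed.

Lemma lb_w_orthonormal a b :
  lb_w a true * lb_w b true + lb_w a false * lb_w b false = (a == b)%:R.
Proof.
have c2 := lb_cos_sq; have s2 := lb_sin_sq; rewrite !expr2 in c2 s2.
by case: a b => [] [] /=; lra.
Qed.

(** The case [d = 1] of the spectral hypothesis, with [x ==> y] as the incidence of [x] in the box
    with corner [y]. All ingredients being products over coordinates, [sum_cube_prod] lifts it to
    every [d]. *)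
Lemma lb_spectral (y y' : bool) :
  lb_q true * (lb_h y * (true ==> y)%:R * (lb_h y' * (true ==> y')%:R)) +
  lb_q false * (lb_h y * (false ==> y)%:R * (lb_h y' * (false ==> y')%:R)) =
  lb_sg true ^+ 2 * (lb_w true y * lb_w true y') +
  lb_sg false ^+ 2 * (lb_w false y * lb_w false y').
Proof.
have c2 := lb_cos_sq; have s2 := lb_sin_sq; have cs := lb_cos_sin.
have r2 := sqrt2_sq; have r3 := sqrt3_sq.
rewrite /lb_q /lb_h /lb_sg /lb_w.
move: lb_cos lb_sin (Num.sqrt 2) (Num.sqrt 3) c2 s2 cs r2 r3 => c s t u c2 s2 cs r2 r3.
have sq1 : ((u - 1) / 3) ^+ 2 = (4 - 2 * u) / 9 by nra.
have sq2 : ((u + 1) / 3) ^+ 2 = (4 + 2 * u) / 9 by nra.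
rewrite sq1 sq2 !expr2 in c2 s2 r2 r3 *.
by case: y y' => [] [] /=; rewrite ?mulNr ?mulrN ?opprK ?(mulrC s c) ?c2 ?s2 ?cs; nra.
Qed.

Lemma natr_forall d (P : 'I_d -> bool) :
  [forall i, P i]%:R = \prod_i (P i)%:R :> R.
Proof.
case: forallP => [H|H]; first by rewrite big1 // => i _; rewrite H.
have /existsP[i Pi] : [exists i, ~~ P i].
  by rewrite -negb_forall; apply/negP => /forallP.
by rewrite (bigD1 i) //= (negPf Pi) mul0r.
Qed.

Lemma b2R_ge0 b : 0 <= b2R b.
Proof. by case: b; rewrite /b2R; lra. Qed.

Lemma b2R_le b b' : (b2R b <= b2R b') = (b ==> b').
Proof. by case: b b' => [] []; rewrite /b2R /= ?lexx ?ler01 // ler10. Qed.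

Definition corner d (y : cube d) : {set cube d} :=
  box_trace (fun=> 0) (fun i => b2R (y i)).

Lemma corner_anchored d (y : cube d) : corner y \in anchored_sys d.
Proof.
by rewrite inE; apply/asboolP; exists (fun i => b2R (y i)); split => // i; apply: b2R_ge0.
Qed.

Lemma mem_corner d (x y : cube d) :
  (x \in corner y)%:R = \prod_i (x i ==> y i)%:R :> R.
Proof.
rewrite -natr_forall inE; congr (nat_of_bool _)%:R.
by apply: eq_forallb => i; rewrite b2R_ge0 b2R_le.
Qed.

Lemma prod_cube_weight d (f : bool -> R) (a : cube d) :
  \prod_i f (a i) =
  f true ^+ #|[pred i | a i]| * f false ^+ (d - #|[pred i | a i]|).
Proof.
rewrite (bigID (fun i => a i)) /=; congr (_ * _).
  by rewrite (eq_bigr (fun=> f true)) => [|i ->//]; rewrite prodr_const.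
rewrite (eq_bigr (fun=> f false)) => [|i /negPf ->//].
rewrite prodr_const; congr (_ ^+ _).
have := cardC [pred i | a i]; rewrite card_ord => cC.
have -> : #|[pred i | ~~ a i]| = #|predC [pred i | a i]| by apply: eq_card.
by rewrite -[X in (X - _)%N]cC addKn.
Qed.

(** The singular values sum to [(lb_sg true + lb_sg false)^d], which is [(2 / sqrt 3)^d]. They are
    constant on each of the [d + 1] Hamming levels, so some level carries an average share. *)
Lemma lb_level_sum d : exists n : nat,
  (2 / Num.sqrt 3) ^+ d <= d.+1%:R *
    (#|[pred a : cube d | #|[pred i | a i]| == n]|%:R *
     (lb_sg true ^+ n * lb_sg false ^+ (d - n))).
Proof.
apply: contrapT => /forallNP H.
pose lev n := #|[pred a : cube d | #|[pred i | a i]| == n]|.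
pose f n := (lev n)%:R * (lb_sg true ^+ n * lb_sg false ^+ (d - n)).
have {}H n : d.+1%:R * f n < (2 / Num.sqrt 3) ^+ d.
  by have /negP := H n; rewrite -ltNge.
have E : \sum_(n < d.+1) f n = (2 / Num.sqrt 3) ^+ d.
  have -> : 2 / Num.sqrt 3 = lb_sg true + lb_sg false.
    rewrite /lb_sg; have := sqrt3_sq; have := sqrt3_gt1.
    move: (Num.sqrt 3) => u u1 u2; have u0 : u != 0 by rewrite gt_eqF //; lra.
    have -> : 2 / u = 2 * u / u ^+ 2 by field.
    by rewrite u2; lra.
  rewrite -[X in _ ^+ X]card_ord -prodr_const.
  rewrite -(sum_cube_prod (fun _ => lb_sg)).
  rewrite (partition_big (fun a : cube d => inord #|[pred i | a i]| : 'I_d.+1) predT) //=.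
  apply: eq_bigr => n _; rewrite /f mulr_natl -sumr_const.
  have cle (a : cube d) : (#|[pred i | a i]| < d.+1)%N.
    by rewrite ltnS -[X in (_ <= X)%N]card_ord max_card.
  apply: eq_big => [a|a]; rewrite !inE.
    by apply/eqP/eqP => [aE|<-]; [apply: val_inj; rewrite /= inordK ?aE | rewrite inordK].
  by move=> /eqP <-; rewrite prod_cube_weight.
have : \sum_(n < d.+1) d.+1%:R * f n < \sum_(n < d.+1) (2 / Num.sqrt 3) ^+ d.
  by apply: ltr_sum => //; apply/hasP; exists ord0; rewrite ?mem_index_enum.
by rewrite -mulr_sumr E sumr_const card_ord -[ltRHS]mulr_natl ltxx.
Qed.

Lemma herdisc_anchored_lower d :
  (2 / Num.sqrt 3) ^+ d <= 14 * d.+1%:R * (herdisc (anchored_sys d))%:R :> R.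
Proof.
have [n Hn] := lb_level_sum d.
set P := [pred a | _] in Hn; set s := _ * _ ^+ (d - n) in Hn.
have sgp a : 0 < lb_sg a by have := sqrt3_gt1; rewrite /lb_sg; case: a => *; lra.
have s0 : 0 < s by rewrite mulr_gt0 // exprn_gt0.
have rho0 : 0 < (2 / Num.sqrt 3) ^+ d :> R.
  by rewrite exprn_gt0 // divr_gt0 // sqrtr_gt0.
have k0 : (0 < #|P|)%N.
  rewrite lt0n; apply/eqP => k0.
  by move: Hn; rewrite k0 mul0r mulr0 leNgt rho0.
have kR0 : 0 < #|P|%:R :> R by rewrite ltr0n.
pose h (y : cube d) := \prod_i lb_h (y i).
pose q (x : cube d) := \prod_i lb_q (x i).
pose w (a y : cube d) := \prod_i lb_w (a i) (y i).
pose sg (a : cube d) := \prod_i lb_sg (a i).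
pose X (x y : cube d) : R := h y * (x \in corner y)%:R.
have XE x y : X x y = \prod_i (lb_h (y i) * (x i ==> y i)%:R).
  by rewrite /X mem_corner /h -big_split.
have spec y y' : \sum_x q x * (X x y * X x y') =
                 \sum_a sg a ^+ 2 * (w a y * w a y').
  under eq_bigr do rewrite !XE /q -!big_split /=.
  under [RHS]eq_bigr do rewrite /sg /w -prodrXl -!big_split /=.
  rewrite (sum_cube_prod (fun i b => lb_q b * (lb_h (y i) * (b ==> y i)%:R *
    (lb_h (y' i) * (b ==> y' i)%:R)))).
  rewrite (sum_cube_prod (fun i a => lb_sg a ^+ 2 * (lb_w a (y i) * lb_w a (y' i)))).
  by apply: eq_bigr => i _; rewrite lb_spectral.
have wo a b : dot (w a) (w b) = (a == b)%:R.
  rewrite /dot; under eq_bigr do rewrite /w -big_split /=.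
  rewrite (sum_cube_prod (fun i y => lb_w (a i) y * lb_w (b i) y)).
  under eq_bigr do rewrite lb_w_orthonormal.
  rewrite -natr_forall; congr (nat_of_bool _)%:R.
  by apply/eqfunP/eqP => [/ffunP|-> //].
have q0 x : 0 <= q x.
  by apply: prodr_ge0 => i _; rewrite /lb_q; case: (x i); lra.
have q1 : \sum_x q x = 1.
  by rewrite (sum_cube_prod (fun _ => lb_q)) big1 // => i _; rewrite /lb_q; lra.
have sP a : P a -> sg a = s.
  by rewrite /P /= => /eqP an; rewrite /sg prod_cube_weight an.
pose g := s * Num.sqrt (#|P|%:R / 2).
have g2 : g ^+ 2 = s ^+ 2 * #|P|%:R / 2.
  by rewrite exprMn sqr_sqrtr ?mulrA // divr_ge0.
have g0 : 0 < g by rewrite mulr_gt0 // sqrtr_gt0 divr_gt0.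
have hh : dot h h <= 1.
  rewrite /dot; under eq_bigr do rewrite /h -big_split /=.
  rewrite (sum_cube_prod (fun _ y => lb_h y * lb_h y)) big1 // => i _.
  have := sqrt3_sq; have := sqrt2_sq; rewrite /lb_h.
  by move: (Num.sqrt 2) (Num.sqrt 3) => t u; rewrite !expr2; nra.
(* Fewer than half of the level's eigenvectors are projected away at each selection, so half of
   their mass survives. *)
have Hk : (uphalf #|P|)%:R * g ^+ 2 <= 44 * (herdisc (anchored_sys d))%:R ^+ 2.
  apply: (herdisc_lower (@corner_anchored d) hh g0) => r e rk on.
  rewrite g2; apply: (spectral_residual spec wo q0 q1 sP _ on).
  by move: rk; rewrite gtn_uphalf_double -mul2n; apply: ltnW.
rewrite g2 in Hk.
have kk : #|P|%:R <= 2 * (uphalf #|P|)%:R :> R.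
  by rewrite -natrM ler_nat mul2n -leq_uphalf_double.
set D := (herdisc _)%:R in Hk *.
have D0 : 0 <= D by rewrite ler0n.
(* From [(k / 2) (s^2 k / 2) <= 44 D^2] one gets [(s k)^2 <= 176 D^2], and [176 <= 14^2]. *)
have sk : s * #|P|%:R <= 14 * D.
  have l0 : 0 <= s * #|P|%:R by rewrite mulr_ge0 // ltW.
  have r0 : 0 <= 14 * D by rewrite mulr_ge0.
  rewrite -(@ler_pXn2r _ 2) // [leLHS]exprMn [leRHS]exprMn.
  have s2 : 0 < s ^+ 2 by rewrite exprn_gt0.
  move: (#|P|%:R) ((uphalf _)%:R) (s ^+ 2) (D ^+ 2) (sqr_ge0 D) kR0 kk s2 Hk.
  move=> k k' S DD DD0 kp kk s2 Hk.
  have : S * k * k <= S * k * (2 * k') by rewrite ler_wpM2l // mulr_ge0 // ltW.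
  by rewrite !expr2; lra.
apply: le_trans Hn _; rewrite [leRHS](_ : _ = d.+1%:R * (14 * D)); last by ring.
by rewrite ler_wpM2l // mulrC.
Qed.

(** * Sub-Gaussian tails of random signs *)

#[local] Arguments exp x%_ring_scope.

Lemma expD (x y : R) : exp (x + y) = exp x * exp y.
Proof. exact: exp_plus. Qed.

Lemma exp_gt0 (x : R) : 0 < exp x.
Proof. by apply/RltP; apply: exp_pos. Qed.

Lemma exp_ge1D (x : R) : 1 + x <= exp x.
Proof. by apply/RleP; apply: exp_ineq1_le. Qed.

Lemma ler_exp (x y : R) : x <= y -> exp x <= exp y.
Proof.
move=> xy; have e1 : 1 <= exp (y - x) by have := exp_ge1D (y - x); lra.
by rewrite -(subrK x y) expD ler_peMl // ltW // exp_gt0.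
Qed.

Lemma exp_prodN (x : R) : exp x * exp (- x) = 1.
Proof. by rewrite -expD subrr; apply: exp_0. Qed.

Lemma exp_sum (I : finType) (F : I -> R) : exp (\sum_i F i) = \prod_i exp (F i).
Proof. by apply: (big_morph exp); [exact: expD | exact: exp_0]. Qed.

(** The generous constant 2 in the exponent leaves only [1 + x <= exp x] to be used. For
    [|y| >= 1/2] one has [|y| <= 2 y^2]; otherwise [exp y <= 1 / (1 - y)] and its mirror image sum
    to at most [2 / (1 - y^2)]. *)
Lemma cosh_le_exp_sqr (y : R) : exp y + exp (- y) <= 2 * exp (2 * y ^+ 2).
Proof.
have [y1|y1] := lerP (1 / 2) `|y|.
  have y2 : `|y| <= 2 * y ^+ 2.
    by rewrite -[y ^+ 2]real_normK ?num_real // expr2; nra.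
  have := ler_norm y; have := ler_norm (- y); rewrite normrN => h1 h2.
  by rewrite mulr_natl mulr2n; apply: lerD; apply: ler_exp; lra.
have : y ^+ 2 <= 1 / 4.
  by rewrite -[y ^+ 2]real_normK ?num_real // expr2; have := normr_ge0 y; nra.
have := exp_ge1D y; have := exp_ge1D (- y); have := exp_prodN y.
have := exp_ge1D (2 * y ^+ 2); have := exp_gt0 y; have := exp_gt0 (- y).
move: y1; rewrite ltr_norml => /andP[ya yb].
move: (exp y) (exp (- y)) (exp (2 * _)) => a b e b0 a0 e1 ab b1 a1 y4.
have ay : a * (1 - y) <= 1 by nra.
have byy : b * (1 + y) <= 1 by nra.
have : (a + b) * (1 - y ^+ 2) <= 2.
  have -> : (a + b) * (1 - y ^+ 2) = a * (1 - y) * (1 + y) + b * (1 + y) * (1 - y) by ring.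
  nra.
move: (y ^+ 2) (sqr_ge0 y) y4 e1 => t t0 t4 e1 h.
have : 2 <= 2 * (1 + 2 * t) * (1 - t) by nra.
nra.
Qed.

Definition sgnR (b : bool) : R := (sgn b)%:~R.

Lemma sgnR_true : sgnR true = 1. Proof. by []. Qed.
Lemma sgnR_false : sgnR false = -1. Proof. by []. Qed.
Lemma sgnR_norm b : `|sgnR b| = 1.
Proof. by case: b; rewrite ?sgnR_true ?sgnR_false ?normrN normr1. Qed.

Lemma chernoff_sum (W : finType) (u : W -> R) (l : R) :
  \sum_(x : {ffun W -> bool}) exp (l * dot (fun w => sgnR (x w)) u)
  <= 2 ^+ #|W| * exp (2 * l ^+ 2 * dot u u).
Proof.
under eq_bigr do rewrite /dot mulr_sumr exp_sum.
rewrite -(bigA_distr_bigA (fun w b => exp (l * (sgnR b * u w)))).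
rewrite /dot mulr_sumr exp_sum -prodr_const -big_split /=.
apply: ler_prod => w _; rewrite big_bool /= sgnR_true sgnR_false mul1r mulN1r mulrN.
rewrite addr_ge0 ?(ltW (exp_gt0 _)) //=.
by have := cosh_le_exp_sqr (l * u w); rewrite exprMn -expr2 mulrA.
Qed.

Lemma chernoff_tail (W : finType) (u : W -> R) (l L : R) :
  #|[set x : {ffun W -> bool} | L < l * dot (fun w => sgnR (x w)) u]|%:R * exp L
  <= 2 ^+ #|W| * exp (2 * l ^+ 2 * dot u u).
Proof.
apply: le_trans (chernoff_sum u l).
rewrite mulr_natl -sumr_const [leRHS](bigID (fun x : {ffun W -> bool} =>
  L < l * dot (fun w => sgnR (x w)) u)) /= -[leLHS]addr0.
apply: lerD; last by apply: sumr_ge0 => x _; rewrite ltW ?exp_gt0.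
rewrite (eq_bigl (fun x : {ffun W -> bool} => L < l * dot (fun w => sgnR (x w)) u));
  last by move=> x; rewrite inE.
by apply: ler_sum => x lx; apply/ler_exp/ltW.
Qed.

Lemma exp_natmul_ge (m : nat) : 2 ^+ m <= exp m%:R.
Proof.
elim: m => [|m IH]; first by rewrite expr0 exp_0.
have -> : m.+1%:R = m%:R + 1 :> R by rewrite natr1.
rewrite expD exprS mulrC; apply: ler_pM => //; first exact: exprn_ge0.
by have := exp_ge1D 1; lra.
Qed.

Lemma hoeffding (W : finType) (u : W -> R) (tau L : R) (m : nat) :
  0 < tau -> dot u u <= tau -> 0 < L -> 16 * m%:R * tau <= L ^+ 2 ->
  #|[set x : {ffun W -> bool} | L < `|dot (fun w => sgnR (x w)) u|]|%:R * 4 ^+ m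
  <= 2 * 2 ^+ #|W| :> R.
Proof.
move=> tau0 utau L0 HL.
(* The minimiser of [2 l^2 tau - l L]. The minimum [- L^2 / (8 tau)] is at most [- 2 m], and
   [4^m <= exp (2 m)]. *)
pose l := L / (4 * tau).
have l0 : 0 < l by rewrite divr_gt0 // mulr_gt0.
have tau1 : tau != 0 by rewrite gt_eqF.
have one (s : R) : s ^+ 2 = 1 ->
    #|[set x : {ffun W -> bool} | L < s * dot (fun w => sgnR (x w)) u]|%:R * 4 ^+ m
    <= 2 ^+ #|W| :> R.
  move=> s1.
  have := chernoff_tail u (s * l) (l * L).
  under eq_finset => x do rewrite (mulrC s l) -(mulrA l s) (ltr_pM2l l0) //.
  set N := #|_|%:R => H.
  have {}H : N * exp (l * L - 2 * (s * l) ^+ 2 * dot u u) <= 2 ^+ #|W|.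
    move: (2 * (s * l) ^+ 2 * _) H => Z H.
    have := ler_wpM2r (ltW (exp_gt0 (- Z))) H.
    by rewrite expD mulrA -[in X in _ <= X -> _]mulrA exp_prodN mulr1.
  apply: le_trans H; rewrite ler_wpM2l ?ler0n //.
  rewrite (_ : 4 = 2 ^+ 2) -?exprM; last by rewrite expr2; lra.
  apply: le_trans (exp_natmul_ge _) _; apply: ler_exp.
  rewrite exprMn s1 mul1r natrM.
  have : 2 * l ^+ 2 * dot u u <= 2 * l ^+ 2 * tau.
    by rewrite ler_wpM2l // mulr_ge0 // sqr_ge0.
  have lL : l * L = 4 * l ^+ 2 * tau by rewrite /l; field.
  have : 8 * (2 * m%:R) <= 16 * l ^+ 2 * tau.
    rewrite -(ler_pM2r tau0); have -> : 16 * l ^+ 2 * tau * tau = L ^+ 2.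
      by rewrite /l; field.
    by move: HL; lra.
  by lra.
have h1 := one 1 (expr1n _ _).
have h2 : #|[set x : {ffun W -> bool} | L < -1 * dot (fun w => sgnR (x w)) u]|%:R
    * 4 ^+ m <= 2 ^+ #|W| :> R by apply: one; rewrite sqrrN expr1n.
rewrite [2 * _]mulr_natl [leRHS]mulr2n; apply: le_trans (lerD h1 h2).
rewrite -mulrDl ler_wpM2r ?exprn_ge0 // -natrD ler_nat.
apply: leq_trans (leq_card_setU _ _); apply/subset_leq_card/subsetP => x.
by rewrite !inE mul1r mulN1r ltr_normr.
Qed.

(** * Partial colouring *)

Lemma card_le_fibres (T B : finType) (G : {set T}) (phi : T -> B) (c : nat) :
  (forall b, (#|[set x in G | phi x == b]| <= c)%N) -> (#|G| <= #|B| * c)%N.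
Proof.
move=> H; rewrite -sum1_card (partition_big phi predT) //= -sum_nat_const.
apply: leq_sum => b _; apply: leq_trans (H b).
by rewrite -sum1_card leq_eqVlt; apply/orP; left; apply/eqP/eq_bigl => x; rewrite !inE.
Qed.

(** A set of at most [h] points is listed by [h] entries of [option W], padded with [None]. *)
Lemma card_small_sets (W : finType) h :
  (#|[set A : {set W} | (#|A| <= h)%N]| <= #|W|.+1 ^ h)%N.
Proof.
pose f (s : {ffun 'I_h -> option W}) : {set W} := [set w | Some w \in codom s].
apply: (@leq_trans #|f @: [set: {ffun 'I_h -> option W}]|); last first.
  apply: leq_trans (leq_imset_card _ _) _.
  by rewrite cardsT card_ffun card_option card_ord.
apply/subset_leq_card/subsetP => A; rewrite inE => Ah.
apply/imsetP; exists [ffun i : 'I_h => nth None (map Some (enum A)) i] => //.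
apply/setP => w; rewrite inE; apply/idP/codomP => [wA|[i]].
  have wi : (index w (enum A) < h)%N.
    by apply: leq_trans Ah; rewrite cardE index_mem mem_enum.
  exists (Ordinal wi); rewrite ffunE /= (nth_map w) ?nth_index ?mem_enum //.
  by rewrite index_mem mem_enum.
rewrite ffunE; have [lt|ge] := ltnP i (size (enum A)).
  by rewrite (nth_map w) // => -[->]; rewrite -mem_enum mem_nth.
by rewrite nth_default // size_map.
Qed.

(** Bessel bounds the sum of [sq] over an orthonormal family by the squared Frobenius norm of [c],
    at most [#|W|]; this limits [r]. If some residual were longer than claimed, Cauchy-Schwarz
    against [b S] would give its normalisation [sq] above [T], and the family could be extended. *)
Lemma maximal_frame (W U Sx : finType) (c : W -> U -> R) (b : Sx -> U -> R)
    (T : nat) (be : R) :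
  (0 < T)%N -> 0 < be -> (forall w, dot (c w) (c w) <= 1) ->
  (forall S, dot (b S) (b S) <= be) ->
  exists (r : nat) (v : nat -> W -> R),
    [/\ orthonormal_upto r v, (r * T <= #|W|)%N &
        forall S, dot (residual r v (fun w => dot (b S) (c w)))
                      (residual r v (fun w => dot (b S) (c w))) <= T%:R * be].
Proof.
move=> T0 be0 c1 bbe.
pose sq (v : W -> R) := \sum_u dot v (fun w => c w u) ^+ 2.
pose Q r := exists v, orthonormal_upto r v /\
  forall a, (a < r)%N -> T%:R <= sq (v a).
have Qle r : Q r -> (r * T <= #|W|)%N.
  move=> [v [on vT]]; rewrite -(@ler_nat R) natrM.
  apply: (@le_trans _ _ (\sum_(a < r) sq (v a))).
    rewrite mulr_natl -{1}(card_ord r) -sumr_const.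
    by apply: ler_sum => a _; apply: vT.
  rewrite exchange_big /=.
  apply: (@le_trans _ _ (\sum_u dot (fun w => c w u) (fun w => c w u))).
    by apply: ler_sum => u _; apply: bessel.
  rewrite /dot exchange_big -sum1_card natr_sum.
  by apply: ler_sum => w _; apply: c1.
have Q0 : exists r, `[< Q r >].
  by exists 0%N; apply/asboolP; exists (fun _ _ => 0).
have Qb r : `[< Q r >] -> (r <= #|W|)%N.
  by move=> /asboolP/Qle; apply: leq_trans; rewrite leq_pmulr.
case: (ex_maxnP Q0 Qb) => r /asboolP[v [on vT]] rmax.
exists r, v; split => //; first by apply: Qle; exists v.
move=> S; pose f w := dot (b S) (c w).
change (dot (residual r v f) (residual r v f) <= T%:R * be).
rewrite leNgt; apply/negP => big.
have N0 : 0 < dot (residual r v f) (residual r v f).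
  by apply: le_lt_trans big; rewrite mulr_ge0 // ltW.
suff /asboolP/rmax : Q r.+1 by rewrite ltnn.
exists (extend r v (unit_residual r v f)); split.
  exact: extend_unit_residual.
move=> a; rewrite ltnS /extend leq_eqVlt => /predU1P[->|ar]; last first.
  by rewrite ltn_eqF // vT.
rewrite eqxx; set n := unit_residual r v f.
have fE : dot n f = dot (b S) (fun u => dot n (fun w => c w u)).
  rewrite {2}/dot; under [RHS]eq_bigr do rewrite /dot mulr_sumr.
  rewrite exchange_big; apply: eq_bigr => w _ /=.
  by rewrite /f /dot mulr_sumr; apply: eq_bigr => u _; rewrite mulrCA.
have := dot_cauchy (b S) (fun u => dot n (fun w => c w u)).
rewrite -fE dot_unit_residual // sqr_sqrtr ?(ltW N0) // => CS.
have : T%:R * be < be * sq n.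
  apply: lt_le_trans big _; apply: le_trans CS _.
  have -> : sq n = dot (fun u => dot n (fun w => c w u)) (fun u => dot n (fun w => c w u)).
    by apply: eq_bigr => u _; rewrite expr2.
  by rewrite ler_wpM2r ?dot_ge0.
by rewrite mulrC ltr_pM2l // => /ltW.
Qed.

(** The shift by [N] makes the floor non-negative when [|t| <= N], so that the rounded values index
    a finite type. *)
Definition bucket (N : nat) (t : R) : nat := absz (Num.floor t + N%:Z).

Lemma floor_abs_bound (N : nat) (t : R) :
  `|t| <= N%:R -> - N%:Z <= Num.floor t <= N%:Z.
Proof.
rewrite ler_norml => /andP[t1 t2]; apply/andP; split.
  by rewrite floor_ge_int rmorphN /=.
by rewrite -(@ler_int R); apply: le_trans t2; exact: floor_le.
Qed.

Lemma bucket_lt (N : nat) (t : R) : `|t| <= N%:R -> (bucket N t < N.*2.+1)%N.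
Proof. by move/floor_abs_bound => /andP[f1 f2]; rewrite /bucket; lia. Qed.

Lemma bucket_eq (N : nat) (t t' : R) :
  `|t| <= N%:R -> `|t'| <= N%:R -> bucket N t = bucket N t' -> `|t - t'| <= 1.
Proof.
move=> /floor_abs_bound /andP[f1 f2] /floor_abs_bound /andP[g1 g2] e.
have fE : Num.floor t = Num.floor t' by move: e; rewrite /bucket; lia.
have := floor_itv t; have := floor_itv t'; rewrite fE rmorphD /= rmorph1.
by rewrite ler_norml => /andP[a1 a2] /andP[b1 b2]; apply/andP; split; lra.
Qed.

(** Otherwise each fibre of [phi] in [G] lies in a Hamming ball of radius [h] about one of its
    members, and [card_small_sets] bounds that ball. *)
Lemma far_pair (W B : finType) (G : {set {ffun W -> bool}})
    (phi : {ffun W -> bool} -> B) (h : nat) :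
  (#|B| * #|W|.+1 ^ h < #|G|)%N ->
  exists x x' : {ffun W -> bool}, [/\ x \in G, x' \in G, phi x = phi x' &
    (h < #|[set w | x w != x' w]|)%N].
Proof.
move=> lt; apply: contrapT => H; move: lt; rewrite ltnNge => /negP; apply.
apply: (card_le_fibres (phi := phi)) => b.
set Gb := [set x in G | _].
have [->|[x0 x0G]] := set_0Vmem Gb; first by rewrite cards0.
pose diff (x : {ffun W -> bool}) := [set w | x w != x0 w].
have dinj : injective diff.
  move=> x x' /setP E; apply/ffunP => w; have := E w; rewrite !inE.
  by case: (x w) (x' w) (x0 w) => [] [] [].
rewrite -(card_imset _ dinj); apply: leq_trans (card_small_sets W h).
apply/subset_leq_card/subsetP => _ /imsetP[x xG ->]; rewrite inE leqNgt.
apply/negP => far; apply: H; exists x, x0.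
move: xG x0G; rewrite !inE => /andP[xG /eqP ->] /andP[x0G /eqP ->].
by split.
Qed.

(** Union bound: each of at most [4^d] sets excludes a proportion of at most [2 / 4^(d+1)] of the
    signings, so at least half remain. *)
Lemma card_good_signs (W Sx : finType) (g : Sx -> W -> R) (tau L : R) (d : nat) :
  0 < tau -> 0 < L -> 16 * d.+1%:R * tau <= L ^+ 2 -> (#|Sx| <= 4 ^ d)%N ->
  (forall S, dot (g S) (g S) <= tau) ->
  (2 ^ #|W| <= 2 * #|[set x : {ffun W -> bool} |
     [forall S, (`|dot (fun w => sgnR (x w)) (g S)| <= L)%R]]|)%N.
Proof.
move=> tau0 L0 HL Sd gt.
set G := [set x | _].
pose bad S := [set x : {ffun W -> bool} | L < `|dot (fun w => sgnR (x w)) (g S)|].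
have cG : (#|~: G| <= \sum_S #|bad S|)%N.
  apply: (@leq_trans #|\bigcup_S bad S|).
    apply/subset_leq_card/subsetP => x; rewrite !inE negb_forall => /existsP[S].
    by rewrite -ltNge => h; apply/bigcupP; exists S => //; rewrite inE.
  elim/big_rec2: _ => [|S m A _ IH]; first by rewrite cards0.
  by apply: leq_trans (leq_card_setU _ _) _; rewrite leq_add2l.
have bd S : (#|bad S| * 4 ^ d.+1 <= 2 * 2 ^ #|W|)%N.
  by rewrite -(@ler_nat R) !natrM !natrX; apply: (hoeffding tau0).
have : (#|~: G| * 4 ^ d.+1 <= 4 ^ d * (2 * 2 ^ #|W|))%N.
  apply: (@leq_trans (\sum_S #|bad S| * 4 ^ d.+1)).
    by rewrite -big_distrl leq_mul2r cG orbT.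
  apply: (@leq_trans (\sum_(S : Sx) 2 * 2 ^ #|W|)); first exact: leq_sum.
  by rewrite sum_nat_const leq_mul2r Sd orbT.
rewrite expnS (mulnA _ 4%N) [(_ * 4 ^ d)%N]mulnC leq_pmul2l ?expn_gt0 // => cc.
have := cardsC G; rewrite card_ffun card_bool => cE; lia.
Qed.

Lemma partial_coloring (W U Sx : finType) (c : W -> U -> R) (b : Sx -> U -> R)
    (d : nat) (be : R) :
  1 <= be -> (forall w, dot (c w) (c w) <= 1) ->
  (forall S, dot (b S) (b S) <= be) ->
  (forall S w, `|dot (b S) (c w)| <= 1) ->
  (#|W| <= 2 ^ d)%N -> (#|Sx| <= 4 ^ d)%N ->
  exists y : W -> option bool,
    (#|W| <= 4 * d.+1 * #|[set w | y w != None]|)%N /\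
    forall S, `|\sum_w sval3 (y w) * dot (b S) (c w)|
              <= 17 * d.+1%:R * Num.sqrt be.
Proof.
move=> be1 c1 bbe bc1 Wd Sd.
have sb1 : 1 <= Num.sqrt be by rewrite -sqrtr1 ler_wsqrtr.
have d1 : 1 <= d.+1%:R :> R by rewrite ler1n.
(* Up to two points are all coloured at once; the pigeonhole count below needs [n >= 3]. *)
have [W2|W3] := leqP #|W| 2.
  exists (fun=> Some true); split.
    rewrite (_ : [set w | _] = setT) ?cardsT; last by apply/setP => w; rewrite !inE.
    by rewrite leq_pmull.
  move=> S; apply: (@le_trans _ _ #|W|%:R).
    by apply: dot_norm_le => // w; rewrite normr1.
  apply: (@le_trans _ _ 2); first by rewrite ler_nat.
  nra.
pose n := #|W|; have n0 : 0 < n%:R :> R by rewrite ltr0n /n; lia.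
have be0 : 0 < be by lra.
(* [T = 4 (3 d + 2)]: a rounded frame coordinate takes [3 d + 2] bits, so the whole frame takes at
   most [n / 4]. *)
have T0 : (0 < 12 * d + 8)%N by rewrite addn_gt0 orbT.
have [r [v [on rT res]]] := maximal_frame T0 be0 c1 bbe.
pose f S w := dot (b S) (c w).
pose L := 16 * d.+1%:R * Num.sqrt be.
pose G := [set x : {ffun W -> bool} |
  [forall S, `|dot (fun w => sgnR (x w)) (residual r v (f S))| <= L]].
have cG : (2 ^ n <= 2 * #|G|)%N.
  apply: (@card_good_signs _ _ _ ((12 * d + 8)%:R * be) _ d) => //.
  - by rewrite mulr_gt0 // ltr0n addn_gt0 orbT.
  - by rewrite /L; nra.
  rewrite /L exprMn sqr_sqrtr ?(ltW be0) // !mulrA ler_pM2r //.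
  by rewrite -!natrM -natrX ler_nat; lia.
(* Frame coordinates are at most [n] in size and are rounded to precision [1 / n^2]. *)
pose N := (n ^ 3)%N.
have vx (x : {ffun W -> bool}) (k : 'I_r) :
    `|n%:R ^+ 2 * dot (fun w => sgnR (x w)) (v k)| <= N%:R.
  have -> : N%:R = n%:R ^+ 2 * n%:R :> R by rewrite /N natrX exprSr.
  rewrite normrM ger0_norm ?exprn_ge0 // ler_pM2l ?exprn_gt0 //.
  apply: dot_norm_le => w; first by rewrite sgnR_norm.
  by apply: entry_le1; rewrite on // eqxx.
pose phi (x : {ffun W -> bool}) : {ffun 'I_r -> 'I_(N.*2.+1)} :=
  [ffun k => inord (bucket N (n%:R ^+ 2 * dot (fun w => sgnR (x w)) (v (val k))))].
pose h := (n %/ (4 * d.+1))%N.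
have [x [x' [xG x'G pE far]]] : exists x x' : {ffun W -> bool},
    [/\ x \in G, x' \in G, phi x = phi x' & (h < #|[set w | x w != x' w]|)%N].
  (* The fibres and the Hamming ball cost at most [n / 4] bits each, and [n / 2 + 1 < n], whereas
     [G] has at least [2^(n - 1)] members. *)
  apply: far_pair; rewrite card_ffun !card_ord.
  have hn : (h * (4 * d.+1) <= n)%N by apply: leq_trunc_div.
  have NB : (N.*2.+1 <= 2 ^ (3 * d + 2))%N.
    have : (N <= 2 ^ (3 * d))%N by rewrite mulnC expnM leq_exp2r.
    rewrite expnD; have : (0 < 2 ^ (3 * d))%N by rewrite expn_gt0.
    by lia.
  have nB : (n.+1 <= 2 ^ d.+1)%N.
    by rewrite expnS; have : (0 < 2 ^ d)%N by [rewrite expn_gt0]; rewrite /n; lia.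
  have e1 : (N.*2.+1 ^ r <= 2 ^ ((3 * d + 2) * r))%N.
    by rewrite expnM; case: (r) => // r'; rewrite leq_exp2r.
  have e2 : (n.+1 ^ h <= 2 ^ (d.+1 * h))%N.
    by rewrite expnM; case: (h) => // h'; rewrite leq_exp2r.
  apply: leq_ltn_trans (leq_mul e1 e2) _; rewrite -expnD.
  have : (2 ^ ((3 * d + 2) * r + d.+1 * h).+1 < 2 ^ n)%N.
    by rewrite ltn_exp2l //; rewrite /n in hn *; nia.
  by rewrite expnS => lt; have := leq_trans lt cG; rewrite ltn_pmul2l.
pose y w := if x w == x' w then None else Some (x w).
have yE w : sval3 (y w) = (sgnR (x w) - sgnR (x' w)) / 2.
  by rewrite /y; case: (x w) (x' w) => [] [] /=; rewrite ?sgnR_true ?sgnR_false; lra.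
have dotY (g : W -> R) : dot (fun w => sval3 (y w)) g =
    (dot (fun w => sgnR (x w)) g - dot (fun w => sgnR (x' w)) g) / 2.
  rewrite /dot -sumrB mulr_suml; apply: eq_bigr => w _; rewrite yE; lra.
exists y; split.
  have -> : [set w | y w != None] = [set w | x w != x' w].
    by apply/setP => w; rewrite !inE /y; case: (x w == x' w).
  have := ltn_ceil n (isT : (0 < 4 * d.+1)%N); rewrite -/h => /ltnW lt.
  by apply: leq_trans lt _; rewrite mulnC leq_mul2l far orbT.
move=> S; rewrite -[X in `|X|]/(dot (fun w => sval3 (y w)) (f S)).
have -> : dot (fun w => sval3 (y w)) (f S) =
    dot (fun w => sval3 (y w)) (residual r v (f S)) +
    \sum_(k < r) dot (v k) (f S) * dot (fun w => sval3 (y w)) (v k).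
  rewrite /residual dotBr (dot_sumr _ (fun (k : 'I_r) w => _)).
  rewrite [X in _ - X](_ : _ = \sum_(k < r) dot (v k) (f S)
    * dot (fun w => sval3 (y w)) (v k)) ?subrK //.
  by apply: eq_bigr => k _; rewrite dotZr.
apply: le_trans (ler_normD _ _) _.
have h1 : `|dot (fun w => sval3 (y w)) (residual r v (f S))| <= L.
  rewrite dotY; move: xG x'G; rewrite !inE => /forallP/(_ S) a1 /forallP/(_ S) a2.
  rewrite normrM [`|2^-1|]ger0_norm ?invr_ge0 //.
  have := ler_normB (dot (fun w => sgnR (x w)) (residual r v (f S)))
                    (dot (fun w => sgnR (x' w)) (residual r v (f S))).
  by lra.
have rn : r%:R <= n%:R :> R by rewrite ler_nat /n; nia.
(* At most [n] terms, each a coefficient of size at most [n] times a discrepancy of size at most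
   [1 / n^2]. This adds 1 to [L], whence 17 in place of 16. *)
have h2 : `|\sum_(k < r) dot (v k) (f S) * dot (fun w => sval3 (y w)) (v k)| <= 1.
  apply: le_trans (ler_norm_sum _ _ _) _.
  apply: (@le_trans _ _ (\sum_(k < r) n%:R^-1)); last first.
    by rewrite sumr_const card_ord -[leLHS]mulr_natl ler_pdivrMr // mul1r.
  apply: ler_sum => k _; rewrite normrM.
  have a1 : `|dot (v k) (f S)| <= n%:R.
    apply: dot_norm_le => w; last exact: bc1.
    by apply: entry_le1; rewrite on // eqxx.
  have a2 : n%:R ^+ 2 * `|dot (fun w => sval3 (y w)) (v k)| <= 1.
    have : `|n%:R ^+ 2 * dot (fun w => sgnR (x w)) (v k) -
             n%:R ^+ 2 * dot (fun w => sgnR (x' w)) (v k)| <= 1.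
      apply: bucket_eq (vx _ _) (vx _ _) _.
      move/ffunP: pE => /(_ k); rewrite !ffunE => /(congr1 (@nat_of_ord _)).
      by rewrite !inordK ?(bucket_lt (vx _ _)).
    rewrite dotY -mulrBr (normrM (n%:R ^+ 2)) (normrM _ 2^-1) [`|2^-1|]ger0_norm ?invr_ge0 //.
    rewrite [`|n%:R ^+ 2|]ger0_norm ?exprn_ge0 //.
    by rewrite (mulrA (n%:R ^+ 2)); move: (_ * `|_ - _|) => z; lra.
  have a3 : 0 <= `|dot (fun w => sval3 (y w)) (v k)| by [].
  rewrite -[leRHS]mul1r ler_pdivlMr //; apply: le_trans a2.
  rewrite expr2 mulrAC; apply: ler_wpM2r => //; exact: ler_wpM2r.
apply: le_trans (lerD h1 h2) _; rewrite /L; nra.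
Qed.

(** * Upper bound for boxes *)

Lemma partial_coloring_set (V U Sx : finType) (c : V -> U -> R) (b : Sx -> U -> R)
    (d : nat) (be : R) (J : {set V}) :
  1 <= be -> (forall v, dot (c v) (c v) <= 1) ->
  (forall S, dot (b S) (b S) <= be) ->
  (forall S v, `|dot (b S) (c v)| <= 1) ->
  (#|V| <= 2 ^ d)%N -> (#|Sx| <= 4 ^ d)%N ->
  exists z : V -> option bool,
    (#|J| <= 4 * d.+1 * #|[set v in J | z v != None]|)%N /\
    forall S, `|\sum_(v in J) sval3 (z v) * dot (b S) (c v)|
              <= 17 * d.+1%:R * Num.sqrt be.
Proof.
move=> be1 c1 bbe bc1 Vd Sd.
pose W : finType := {v : V | v \in J}.
have cW : #|W| = #|J| by rewrite card_sig; apply: eq_card => v; rewrite inE.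
have Wd : (#|W| <= 2 ^ d)%N by rewrite cW (leq_trans _ Vd) // max_card.
have [y [yW yS]] := partial_coloring be1 (fun w : W => c1 (val w)) bbe
  (fun S w => bc1 S _) Wd Sd.
pose z v := if insub v is Some w then y w else None.
have zE (w : W) : z (val w) = y w by rewrite /z valK.
exists z; split.
  rewrite -cW; apply: leq_trans yW _; rewrite leq_mul2l orFb.
  rewrite -!sum1dep_card.
  rewrite big_sub_cond /=; apply: eq_leq; apply: eq_bigl => w.
  by rewrite zE.
move=> S; rewrite big_sub; apply: le_trans (yS S).
by rewrite le_eqVlt; apply/orP; left; apply/eqP; congr `|_|; apply: eq_bigr => w _; rewrite zE.
Qed.

(** Each round leaves at most a fraction [(4 d + 3) / (4 d + 4)] of the points uncoloured and adds
    one partial discrepancy. The condition on [t] says that less than one point is left after [t]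
    rounds. *)
Lemma full_coloring (V U Sx : finType) (c : V -> U -> R) (b : Sx -> U -> R)
    (d t : nat) (be : R) (J : {set V}) :
  1 <= be -> (forall v, dot (c v) (c v) <= 1) ->
  (forall S, dot (b S) (b S) <= be) ->
  (forall S v, `|dot (b S) (c v)| <= 1) ->
  (#|V| <= 2 ^ d)%N -> (#|Sx| <= 4 ^ d)%N ->
  (#|J| * (4 * d + 3) ^ t < (4 * d + 3).+1 ^ t)%N ->
  exists x : {ffun V -> bool}, forall S,
    `|\sum_(v in J) sgnR (x v) * dot (b S) (c v)|
    <= t%:R * (17 * d.+1%:R * Num.sqrt be).
Proof.
move=> be1 c1 bbe bc1 Vd Sd; elim: t J => [|t IH] J Jt.
  exists [ffun=> true] => S; rewrite big1 ?normr0 ?mul0r // => v vJ.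
  by move: Jt; rewrite !expn0 muln1 ltnS leqn0 cards_eq0 => /eqP J0; rewrite J0 inE in vJ.
have [z [zJ zS]] := partial_coloring_set J be1 c1 bbe bc1 Vd Sd.
pose J' := [set v in J | z v == None].
have [|x' Hx'] := IH J'.
  have cJ : (#|J| = #|J'| + #|[set v in J | z v != None]|)%N.
    rewrite -(cardsID [set v | z v == None] J); congr (_ + _)%N.
      by apply: eq_card => v; rewrite !inE.
    by apply: eq_card => v; rewrite !inE andbC.
  have cJ' : (#|J'| * (4 * d + 3).+1 <= #|J| * (4 * d + 3))%N by lia.
  rewrite -(@ltn_pmul2r (4 * d + 3).+1) // -expnSr; apply: leq_ltn_trans Jt.
  by rewrite mulnAC expnS mulnA leq_mul2r cJ' orbT.
exists [ffun v => if z v is Some b then b else x' v] => S.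
rewrite (bigID (fun v => z v == None)) /= -natr1 mulrDl mul1r.
apply: le_trans (ler_normD _ _) _; apply: lerD.
  apply: le_trans (Hx' S); rewrite le_eqVlt; apply/orP; left; apply/eqP.
  congr `|_|; apply: eq_big => [v|v /andP[_ /eqP zv]]; first by rewrite !inE.
  by rewrite ffunE zv.
apply: le_trans (zS S); rewrite le_eqVlt; apply/orP; left; apply/eqP.
rewrite [in RHS](bigID (fun v => z v == None)) /= [X in _ = `|X + _|]big1 ?add0r.
  congr `|_|; apply: eq_bigr => v /andP[_]; rewrite ffunE.
  by case: (z v).
by move=> v /andP[_ /eqP ->]; rewrite mul0r.
Qed.

Lemma bernoulli_nat (p m : nat) : (p ^ m.+1 + m.+1 * p ^ m <= p.+1 ^ m.+1)%N.
Proof.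
elim: m => [|m IH]; first by rewrite !expn1 expn0; lia.
have := leq_mul (leqnn p.+1) IH; rewrite -expnS; apply: leq_trans.
by rewrite (expnS p m.+1) (expnS p m); nia.
Qed.

(** By Bernoulli [(1 + 1/p)^(p+1) > 2], so [p + 1] rounds more than halve the points. *)
Lemma rounds_suffice (p d n : nat) : (0 < p)%N -> (0 < d)%N -> (n <= 2 ^ d)%N ->
  (n * p ^ (p.+1 * d) < p.+1 ^ (p.+1 * d))%N.
Proof.
move=> p0 d0 nd; rewrite (expnM p) (expnM p.+1).
apply: (@leq_ltn_trans ((2 * p ^ p.+1) ^ d)%N); first by rewrite expnMn leq_mul2r nd orbT.
rewrite ltn_exp2r //; apply: leq_trans (bernoulli_nat p p).
have : (0 < p ^ p)%N by rewrite expn_gt0 p0.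
by rewrite (mulSn p) -expnS; lia.
Qed.

(* One coordinate of the optimal factorization: [ub_c false] and [ub_c true] are
   unit vectors at angle [PI / 3], and [ub_b] is the dual basis together with
   its sum (for [None], the whole side). *)
Definition ub_c (v u : bool) : R :=
  if v then (if u then Num.sqrt 3 / 2 else 1 / 2) else (if u then 0 else 1).
Definition ub_b (s : option bool) (u : bool) : R :=
  match s with
  | Some false => if u then - (Num.sqrt 3 / 3) else 1
  | Some true => if u then 2 * Num.sqrt 3 / 3 else 0
  | None => if u then Num.sqrt 3 / 3 else 1
  end.
Definition in_side (s : option bool) (v : bool) : bool :=
  if s is Some b then b == v else true.

Lemma ub_dot s v :
  ub_b s true * ub_c v true + ub_b s false * ub_c v false = (in_side s v)%:R.
Proof.
have := sqrt3_sq; rewrite /ub_b /ub_c; move: (Num.sqrt 3) => u; rewrite expr2 => u2.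
by case: s v => [[]|] [] /=; lra.
Qed.

Lemma ub_c_norm v : ub_c v true * ub_c v true + ub_c v false * ub_c v false = 1.
Proof.
have := sqrt3_sq; rewrite /ub_c; move: (Num.sqrt 3) => u; rewrite expr2 => u2.
by case: v; lra.
Qed.

Lemma ub_b_norm s : ub_b s true * ub_b s true + ub_b s false * ub_b s false = 4 / 3.
Proof.
have := sqrt3_sq; rewrite /ub_b; move: (Num.sqrt 3) => u; rewrite expr2 => u2.
by case: s => [[]|]; lra.
Qed.

Lemma dot_tensor d (f g : 'I_d -> bool -> R) :
  dot (fun u : cube d => \prod_i f i (u i)) (fun u => \prod_i g i (u i)) =
  \prod_i (f i true * g i true + f i false * g i false).
Proof.
rewrite /dot /=; under eq_bigr do rewrite -big_split /=.
exact: (sum_cube_prod (fun i b => f i b * g i b)).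
Qed.

(** Per coordinate a box meets {0,1} in no point, one point or both; a single empty coordinate
    empties the box. *)
Lemma box_subcube d (S : {set cube d}) : S \in boxes_sys d ->
  S = set0 \/ exists s : {ffun 'I_d -> option bool},
    forall x : cube d, (x \in S) = [forall i, in_side (s i) (x i)].
Proof.
rewrite inE => /asboolP[a [b ->]].
pose ok i v := (a i <= b2R v) && (b2R v <= b i).
have [/existsP[i Hi]|] := boolP [exists i, ~~ ok i true && ~~ ok i false].
  left; apply/setP => x; rewrite !inE; apply/negP => /forallP/(_ i).
  by rewrite -/(ok i (x i)); case: (x i) Hi => /andP[h1 h2]; apply/negP.
rewrite negb_exists => /forallP H; right.
exists [ffun i => if ok i true then (if ok i false then None else Some true)
                  else Some false] => x.
rewrite inE; apply: eq_forallb => i; rewrite -/(ok i (x i)) ffunE; have := H i.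
by case: (x i); case: (ok i true); case: (ok i false).
Qed.

Lemma herdisc_le_real (V : finType) (F : {set {set V}}) (E : R) : 0 <= E ->
  (forall J : {set V}, exists x : {ffun V -> bool}, forall S, S \in F ->
    `|\sum_(v in S :&: J) sgnR (x v)| <= E) ->
  (herdisc F)%:R <= E.
Proof.
move=> E0 H; rewrite -truncn_ge_nat //; apply: herdisc_le => J.
have [x Hx] := H J; exists x => S SF.
by rewrite truncn_ge_nat // absz_sum_sgn Hx.
Qed.

Lemma herdisc_boxes_upper d : (0 < d)%N ->
  (herdisc (boxes_sys d))%:R <= 68 * d.+1%:R ^+ 3 * (2 / Num.sqrt 3) ^+ d :> R.
Proof.
move=> d0.
have r3 : 0 < Num.sqrt 3 :> R by have := sqrt3_gt1; lra.
have rho0 : 0 <= (2 / Num.sqrt 3) ^+ d :> R.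
  by rewrite exprn_ge0 // divr_ge0 // ltW.
apply: herdisc_le_real => [|J]; first by rewrite mulr_ge0 // mulr_ge0 // exprn_ge0.
pose c (v u : cube d) := \prod_i ub_c (v i) (u i).
pose b (s : {ffun 'I_d -> option bool}) (u : cube d) := \prod_i ub_b (s i) (u i).
have bcE s v : dot (b s) (c v) = [forall i, in_side (s i) (v i)]%:R.
  rewrite (dot_tensor (fun i => ub_b (s i)) (fun i => ub_c (v i))) natr_forall.
  by apply: eq_bigr => i _; rewrite ub_dot.
have c1 v : dot (c v) (c v) <= 1.
  rewrite (dot_tensor (fun i => ub_c (v i)) (fun i => ub_c (v i))) big1 // => i _.
  by rewrite ub_c_norm.
have bb s : dot (b s) (b s) <= (4 / 3) ^+ d.
  rewrite (dot_tensor (fun i => ub_b (s i)) (fun i => ub_b (s i))).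
  rewrite (eq_bigr (fun=> 4 / 3)) => [|i _]; last by rewrite ub_b_norm.
  by rewrite prodr_const card_ord.
have be1 : 1 <= (4 / 3) ^+ d :> R by rewrite exprn_ege1 //; lra.
have bc1 s v : `|dot (b s) (c v)| <= 1.
  by rewrite bcE; case: [forall i, _]; rewrite ?normr1 ?normr0.
have Vd : (#|cube d| <= 2 ^ d)%N by rewrite card_ffun card_bool card_ord.
have Sd : (#|{ffun 'I_d -> option bool}| <= 4 ^ d)%N.
  by rewrite card_ffun card_option card_bool card_ord leq_exp2r.
have sqE : Num.sqrt ((4 / 3) ^+ d) = (2 / Num.sqrt 3) ^+ d :> R.
  rewrite -[RHS]ger0_norm // -sqrtr_sqr -exprM mulnC exprM; congr (Num.sqrt (_ ^+ _)).
  by rewrite expr_div_n sqrt3_sq expr2; lra.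
have p0 : (0 < 4 * d + 3)%N by lia.
have JV : (#|J| <= 2 ^ d)%N by apply: leq_trans Vd; apply: max_card.
have [x Hx] := full_coloring be1 c1 bb bc1 Vd Sd (rounds_suffice p0 d0 JV).
exists x => S /box_subcube[->|[s sE]].
  by rewrite set0I big_set0 normr0 mulr_ge0 // mulr_ge0 // exprn_ge0.
have -> : \sum_(v in S :&: J) sgnR (x v) =
    \sum_(v in J) sgnR (x v) * dot (b s) (c v).
  rewrite (eq_bigl (fun v => (v \in J) && (v \in S))) ?big_mkcondr /=; last first.
    by move=> v; rewrite inE andbC.
  apply: eq_bigr => v _; rewrite bcE -sE.
  by case: (v \in S); rewrite ?mulr1 ?mulr0.
apply: le_trans (Hx s) _; rewrite sqE.
(* There are [4 (d + 1) d] rounds, each costing [17 (d + 1)] times the norm; [68 = 4 * 17]. *)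
rewrite natrM mulrA ler_wpM2r //.
have -> : (4 * d + 3).+1%:R = 4 * d.+1%:R :> R by rewrite -natrM; congr _%:R; lia.
have : d%:R <= d.+1%:R :> R by rewrite ler_nat.
have : 1 <= d.+1%:R :> R by rewrite ler1n.
move: (d.+1%:R) (d%:R) => D D' D1 DD; rewrite !exprS expr0 mulr1; nra.
Qed.

(** * Asymptotics *)

#[local] Arguments ln x%_ring_scope.

Lemma lnM (x y : R) : 0 < x -> 0 < y -> ln (x * y) = ln x + ln y.
Proof. by move=> /RltP x0 /RltP y0; apply: ln_mult. Qed.

Lemma lnX (x : R) n : 0 < x -> ln (x ^+ n) = n%:R * ln x.
Proof.
move=> x0; elim: n => [|n IH]; first by rewrite expr0 mul0r; apply: ln_1.
by rewrite exprS lnM ?exprn_gt0 // IH mulrSr mulrDl mul1r addrC.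
Qed.

Lemma ler_ln (x y : R) : 0 < x -> x <= y -> ln x <= ln y.
Proof.
move=> /RltP x0; rewrite le_eqVlt => /predU1P[-> //|/RltP xy].
by apply/ltW/RltP; apply: ln_increasing.
Qed.

Lemma ln_le_subr1 (x : R) : 0 < x -> ln x <= x - 1.
Proof.
move=> x0; have := exp_ge1D (ln x); rewrite exp_ln; last exact/RltP.
by lra.
Qed.

Lemma ln_le_sqrt (x : R) : 0 < x -> ln x <= 2 * Num.sqrt x.
Proof.
move=> x0; have s0 : 0 < Num.sqrt x by rewrite sqrtr_gt0.
rewrite -{1}(sqr_sqrtr (ltW x0)) lnX //.
by have := ln_le_subr1 s0; lra.
Qed.

Lemma ln2_gt0 : 0 < ln 2.
Proof.
rewrite -[ltLHS](ln_1 : ln 1 = 0); apply/RltP; apply: ln_increasing;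
  by apply/RltP; rewrite ?ltr01 ?ltr1n.
Qed.

Lemma c0E : c0 = ln (2 / Num.sqrt 3) / ln 2.
Proof. by rewrite /c0 /log2 !RealsE. Qed.

(** After taking logarithms the polynomial factors contribute [O(ln d)], bounded through
    [ln_le_sqrt] by [72 sqrt d], which is negligible after division by [d]. *)
Lemma growth_rate_cv (H : nat -> nat) :
  (forall d, (0 < d)%N ->
     (2 / Num.sqrt 3) ^+ d <= 14 * d.+1%:R * (H d)%:R :> R) ->
  (forall d, (0 < d)%N ->
     (H d)%:R <= 68 * d.+1%:R ^+ 3 * (2 / Num.sqrt 3) ^+ d :> R) ->
  Un_cv (fun d => Rdiv (log2 (INR (H d))) (INR d)) c0.
Proof.
move=> lo up eps /RltP eps0; rewrite c0E.
set rho := 2 / Num.sqrt 3 in lo up *.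
have rho0 : 0 < rho by rewrite divr_gt0 // sqrtr_gt0.
have l2 := ln2_gt0.
pose B := 72 / (eps * ln 2).
have B0 : 0 < B by rewrite divr_gt0 // mulr_gt0.
(* The successor ensures both [B < sqrt d] and [d > 0]. *)
exists (Num.truncn (B ^+ 2)).+1 => d /ssrnat.leP dN.
have d0 : (0 < d)%N by apply: leq_trans dN.
have dR0 : 0 < d%:R :> R by rewrite ltr0n.
have Bd : B ^+ 2 < d%:R by apply: lt_le_trans (truncnS_gt _) _; rewrite ler_nat.
apply/RltP; rewrite /log2 !RealsE.
have rd : 0 < rho ^+ d by rewrite exprn_gt0.
have H0 : 0 < (H d)%:R :> R.
  have := lt_le_trans rd (lo d d0); rewrite pmulr_rgt0 // mulr_gt0 //.
set h := (H d)%:R in H0 *.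
have S0 : 0 < d.+1%:R :> R by rewrite ltr0n.
have S1 : 1 <= d.+1%:R :> R by rewrite ler1n.
have Lnn (a : R) : 1 <= a -> 0 <= ln a.
  by move=> a1; rewrite -[X in X <= _](ln_1 : ln 1 = 0); apply: ler_ln.
have lo' : d%:R * ln rho <= ln 14 + ln d.+1%:R + ln h.
  by rewrite -lnX // -!lnM ?mulr_gt0 //; apply: ler_ln => //; apply: lo.
have up' : ln h <= ln 68 + 3 * ln d.+1%:R + d%:R * ln rho.
  rewrite -!lnX // -!lnM ?mulr_gt0 ?exprn_gt0 //; apply: ler_ln => //; exact: up.
have l14 : ln 14 <= ln 68 by apply: ler_ln; lra.
have l68 : 0 <= ln 68 by apply: Lnn; lra.
have lS := Lnn _ S1.
(* Since [d >= 1], [68 (d + 1) <= 144 d]; [ln_le_sqrt] doubles the root 12 to 24, and three such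
   errors make 72. *)
have err : ln 68 + ln d.+1%:R <= 24 * Num.sqrt d%:R.
  rewrite -lnM //; apply: le_trans (ln_le_sqrt _) _; first by rewrite mulr_gt0.
  have : Num.sqrt (68 * d.+1%:R) <= 12 * Num.sqrt d%:R :> R.
    rewrite -(@ler_pXn2r _ 2) ?nnegrE ?mulr_ge0 ?sqrtr_ge0 // exprMn.
    rewrite !sqr_sqrtr //; last by rewrite mulr_ge0.
    have : 1 <= d%:R :> R by rewrite ler1n.
    have : d.+1%:R = d%:R + 1 :> R by rewrite natr1.
    by rewrite expr2; lra.
  by lra.
have close : `|ln h - d%:R * ln rho| <= 72 * Num.sqrt d%:R.
  by rewrite ler_norml; apply/andP; split; lra.
pose s : R := Num.sqrt d%:R.
have s0 : 0 < s by rewrite sqrtr_gt0.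
have s2 : s ^+ 2 = d%:R by rewrite sqr_sqrtr ?ltW.
have Bs : B < s by rewrite -(@ltr_pXn2r _ 2) ?nnegrE ?(ltW B0) ?(ltW s0) // s2.
have -> : ln h / ln 2 / d%:R - ln rho / ln 2 = (ln h - d%:R * ln rho) / (ln 2 * d%:R).
  by field; rewrite !gt_eqF.
have den : 0 < ln 2 * d%:R by rewrite mulr_gt0.
rewrite normrM normfV [`|ln 2 * _|]gtr0_norm // ltr_pdivrMr //.
apply: le_lt_trans close _; rewrite -/s -s2.
have -> : eps * (ln 2 * s ^+ 2) = eps * ln 2 * s * s by ring.
rewrite ltr_pM2r //; move: Bs; rewrite /B ltr_pdivrMr ?mulr_gt0 //.
by rewrite mulrC.
Qed.

Lemma anchored_subset_boxes d : anchored_sys d \subset boxes_sys d.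
Proof.
apply/subsetP => S; rewrite !inE => /asboolP[b [_ SE]].
by apply/asboolP; exists (fun=> 0), b.
Qed.

(* herdisc C_d = 2^(c0 d + o(d)), i.e. log2(herdisc C_d) / d --> c0,
   and the same for the anchored-box system A_d. *)
Theorem theorem6p1 :
  Un_cv (fun d => Rdiv (log2 (INR (herdisc (boxes_sys d)))) (INR d)) c0 /\
  Un_cv (fun d => Rdiv (log2 (INR (herdisc (anchored_sys d)))) (INR d)) c0.
Proof.
have sub d : (herdisc (anchored_sys d))%:R <= (herdisc (boxes_sys d))%:R :> R.
  by rewrite ler_nat herdisc_subset // anchored_subset_boxes.
split; apply: growth_rate_cv => d d0.
- apply: le_trans (herdisc_anchored_lower d) _.
  by rewrite ler_wpM2l // mulr_ge0.
- exact: herdisc_boxes_upper.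
- exact: herdisc_anchored_lower.
- exact: le_trans (sub d) (herdisc_boxes_upper d0).
Qed.
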